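(* Let $k$ be a number field and let $1 \le L < N$ be integers. Let $\mathcal Z = A k^L \subseteq k^N$ be a subspace of dimension $L$, where $A$ is an $N \times L$ matrix over $k$ whose columns form a basis of $\mathcal Z$. Let $B$ be a nonsingular $L \times L$ submatrix of $A$ (formed by $L$ of the rows of $A$), and let $\omega_1, \dots, \omega_L$ be the column vectors of the $N\times L$ matrix $AB^{-1}$. Then $\omega_1, \dots, \omega_L$ is a basis for $\mathcal Z$ over $k$ consisting of $(N-L+1)$-sparse vectors, and it has the following properties. For a nonempty subset $I \subseteq \{1, \dots, L\}$ put $\mathcal Y_I = \operatorname{span}_k\{\omega_i : i \in I\}$. Then $$H(\mathcal Y_I) \le H(\mathcal Z)$$ for every nonempty $I$; in particular $\max_{1 \le i \le L} H(\omega_i) \le H(\mathcal Z)$. Moreover, if $\emptyset \neq I_1 \subsetneq I_2 \subseteq \{1, \dots, L\}$, then $$H(\mathcal Y_{I_1}) \le H(\mathcal Y_{I_2}),$$ with equality if and only if $\omega_i$ is a standard basis vector of $k^N$ for each $i \in I_2 \setminus I_1$.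
   Context: Let $k$ be a number field of degree $d=[k:\mathbb Q]$, $M(k)$ its set of places, and for $v\in M(k)$ let $d_v=[k_v:\mathbb Q_v]$ be the local degree. Absolute values $|\cdot|_v$ are normalized to extend the usual archimedean absolute value on $\mathbb Q$ if $v\mid\infty$, or the usual $p$-adic absolute value if $v\mid p$; then the product formula $\prod_v |\beta|_v^{d_v}=1$ holds for nonzero $\beta\in k$. For $\beta=(\beta_1,\dots,\beta_n)\in k^n$ let $|\beta|_v=\max_j|\beta_j|_v$ and, for $v\mid\infty$, $\|\beta\|_v=(\sum_j|\beta_j|_v^2)^{1/2}$. The (Arakelov) height of a nonzero vector is $H(\beta)=\big(\prod_{v\nmid\infty}|\beta|_v^{d_v}\prod_{v\mid\infty}\|\beta\|_v^{d_v}\big)^{1/d}$; it does not depend on the number field containing the coordinates. For a subspace $\mathcal Z\subseteq k^N$ of dimension $L$ with $N\times L$ basis matrix $X$ (columns form a basis), $H(\mathcal Z)=H(X)$ is defined as the height of the vector in $k^{\binom NL}$ of Grassmann coordinates of $\mathcal Z$, i.e. of all $L\times L$ minors of $X$ (this is independent of the chosen basis); by convention $H(\{0\})=H(k^N)=1$. For a full-rank matrix, $H$ of the matrix means the height of the subspace spanned by its columns (equivalently the height of the vector of its maximal minors). A vector in $k^N$ is $s$-sparse if it has at most $s$ nonzero coordinates. *)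

(* Defs.v *)
From HB Require Import structures.
From mathcomp Require Import all_boot all_order all_algebra all_field.
From mathcomp Require Import all_classical all_reals exp.
Set Implicit Arguments.
Unset Strict Implicit.
Unset Printing Implicit Defensive.
Import Order.TTheory GRing.Theory Num.Theory.
Local Open Scope classical_set_scope.
Local Open Scope ring_scope.

Section Heights.
Variables (R : realType) (k : fieldExtType rat).

Definition padic_abs (p : nat) (q : rat) : R :=
  if q == 0 then 0
  else (p%:R : R) ^ (- ((logn p (absz (numq q)))%:Z - (logn p (absz (denq q)))%:Z)).

Definition is_absval (a : k -> R) : Prop :=
  [/\ forall x, 0 <= a x,
      forall x, a x = 0 <-> x = 0,
      forall x y, a (x * y) = a x * a y &
      forall x y, a (x + y) <= a x + a y].

Definition arch_over (a : k -> R) : Prop := forall q : rat, a q%:A = `|ratr q|.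
Definition padic_over (p : nat) (a : k -> R) : Prop :=
  forall q : rat, a q%:A = padic_abs p q.

(* M(k): places of k, each represented by its unique absolute value normalised
   to extend the usual archimedean or p-adic absolute value of Q. *)
Definition arch_places : set (k -> R) := [set a | is_absval a /\ arch_over a].
Definition nonarch_places : set (k -> R) :=
  [set a | is_absval a /\ exists p, prime p /\ padic_over p a].

(* Local degree d_v = [k_v : Q_v].  Q_v is the completion of Q, its elements
   being represented by |.|_v-Cauchy sequences of rationals; an element of Q_v
   is zero iff its sequence tends to 0; k_v is spanned over Q_v by k, so d_v is
   the maximal number of elements of k that are linearly independent over Q_v
   inside k_v, where sum_i c_i x_i = 0 in k_v iff |sum_i c_i(n) x_i|_v -> 0. *)
Definition vcauchy (a : k -> R) (c : nat -> rat) : Prop :=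
  forall e : R, 0 < e -> exists M, forall m n, (M <= m)%N -> (M <= n)%N ->
    a (c m - c n)%:A < e.
Definition vnull (a : k -> R) (s : nat -> k) : Prop :=
  forall e : R, 0 < e -> exists M, forall n, (M <= n)%N -> a (s n) < e.
Definition local_indep (a : k -> R) (m : nat) (x : 'I_m -> k) : Prop :=
  ~ exists c : 'I_m -> nat -> rat,
      [/\ forall i, vcauchy a (c i),
          exists i, ~ vnull a (fun n => (c i n)%:A) &
          vnull a (fun n => \sum_(i < m) c i n *: x i)].
Definition local_degree (a : k -> R) : nat :=
  \max_(m < (\dim {:k}).+1 | `[< exists x : 'I_m -> k, local_indep a x >]) m.

Definition vmax (a : k -> R) (I : finType) (b : I -> k) : R :=
  \big[Num.max/0]_(i : I) a (b i).
Definition vl2 (a : k -> R) (I : finType) (b : I -> k) : R :=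
  Num.sqrt (\sum_(i : I) a (b i) ^+ 2).

Definition height (I : finType) (b : I -> k) : R :=
  powR ((\big[*%R/1]_(a \in nonarch_places) vmax a b ^+ local_degree a) *
        (\big[*%R/1]_(a \in arch_places) vl2 a b ^+ local_degree a))
       ((\dim {:k})%:R^-1).

Definition minor (N L : nat) (X : 'M[k]_(N, L)) (S : {set 'I_N}) : k :=
  \det (\matrix_(i < L, j < L) nth 0 [seq X r j | r <- enum S] i).

Definition grassmann (N L : nat) (X : 'M[k]_(N, L)) :
  {S : {set 'I_N} | #|S| == L} -> k := fun S => minor X (val S).

Definition subspace_height (N : nat) (W : {vspace 'cV[k]_N}) : R :=
  height (grassmann (\matrix_(i < N, j < \dim W) tnth (vbasis W) j i 0)).

Definition vec_height (N : nat) (v : 'cV[k]_N) : R := height (fun j : 'I_N => v j 0).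

End Heights.

(* Main.v *)
Require Import Defs.
From HB Require Import structures.
From mathcomp Require Import all_boot all_order all_algebra all_field.
From mathcomp Require Import reals.
From mathcomp Require Import all_classical all_reals exp ring lra perm finset.
Set Implicit Arguments.
Unset Strict Implicit.
Unset Printing Implicit Defensive.
Import Order.TTheory GRing.Theory Num.Theory.
Local Open Scope ring_scope.

(** The omega_i have the identity matrix as their rows r, so every maximal
    minor of Y_{I_1} is, up to sign, a maximal minor of Y_{I_2}: a nonzero minor
    of Y_{I_1} uses a row set S disjoint from T = r(I_2 \ I_1), and it is the
    minor of Y_{I_2} on S u T.  All local norms therefore increase from Y_{I_1}
    to Y_{I_2}, strictly so at an archimedean place unless every nonzero minor of
    Y_{I_2} uses all the rows T, and this means that the new omega_i are standard
    basis vectors.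

    The heights are independent of the choice of a basis by the product formula,
    proved here without completions or Galois theory.  Fix an absolute value w of
    Q.  It extends to the number field M generated by the conjugates of k: a
    minimal submultiplicative seminorm on M, bounded on Q by w, is multiplicative.
    With b such an extension, the places of k above w are the maps b o s, for
    s : k -> M an embedding, and the local degree of a is the number of s with
    b o s = a.  Indeed it is at least this number by a Vandermonde argument, while
    the local degrees above w add up to at most [k : Q], by weak approximation and
    the total boundedness of the unit ball of (Q, w).  Thus
    prod_(a | w) a(c)^(d_a) = b(prod_s s(c)) = w(det(x |-> c x)), and the product
    formula of Q applies. *)

(** * Submultiplicative seminorms *)

(* [is_absval] over an arbitrary field, so that it also applies to [rat]. *)
Definition absval (R : realType) (F : fieldType) (a : F -> R) : Prop :=
  [/\ forall x, 0 <= a x, forall x, a x = 0 <-> x = 0,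
      forall x y, a (x * y) = a x * a y & forall x y, a (x + y) <= a x + a y].

(** Bernoulli's inequality for [1 + h = x^-1] makes the powers of [x^-1] unbounded. *)
Lemma expr_lt_small (R : realType) (x e : R) : 0 <= x -> x < 1 -> 0 < e ->
  exists i, x ^+ i < e.
Proof.
move=> x0 x1 e0; case: (eqVneq x 0) => [->|xN0]; first by exists 1%N; rewrite expr1.
have xp : 0 < x by rewrite lt0r xN0.
pose h := x^-1 - 1.
have hp : 0 < h by rewrite subr_gt0 invf_gt1.
have bern i : 1 + h *+ i <= (1 + h) ^+ i.
  elim: i => [|i IH]; first by rewrite expr0 mulr0n addr0.
  rewrite exprS; have := ler_wpM2l (addr_ge0 ler01 (ltW hp)) IH.
  apply: le_trans; rewrite mulrDl mul1r mulrDr mulr1 mulrS [h + _]addrC addrA.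
  by rewrite lerD2l lerDl mulr_ge0 ?mulrn_wge0 // ltW.
have eh0 : 0 <= e^-1 / h by rewrite divr_ge0 // ?invr_ge0 ltW.
exists (Num.bound (e^-1 / h)); have := archi_boundP eh0.
rewrite ltr_pdivrMr // => lt_i.
rewrite -[x]invrK exprVn -[ltRHS]invrK ltf_pV2 ?posrE ?invr_gt0 ?exprn_gt0 ?invr_gt0 //.
apply: lt_le_trans lt_i _; have := bern (Num.bound (e^-1 / h)).
have -> : 1 + h = x^-1 by rewrite /h addrC subrK.
by apply: le_trans; rewrite mulr_natl lerDr ler01.
Qed.

Section Seminorms.
Variables (R : realType) (M : fieldExtType rat) (w : rat -> R).

(** On Q only an upper bound is imposed, so that the condition survives infima; equality with [w] is
    recovered in [minimal_seminorm_absval]. *)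
Definition seminorm_below (n : M -> R) : Prop :=
  [/\ forall x, 0 <= n x, n 1 = 1, forall x y, n (x + y) <= n x + n y,
      forall x y, n (x * y) <= n x * n y & forall q : rat, n q%:A <= w q].

Lemma le_mul_inf (A B : set R) (c : R) : (A !=set0)%classic -> (B !=set0)%classic ->
  (forall r, A r -> 0 <= r) -> (forall r, B r -> 0 <= r) ->
  (forall r s, A r -> B s -> c <= r * s) -> c <= inf A * inf B.
Proof.
move=> A0 B0 Ap Bp H.
have step (r : R) (C : set R) : 0 <= r -> (C !=set0)%classic ->
    (forall s, C s -> c <= r * s) -> c <= r * inf C.
  move=> r0 C0 HC; case: (eqVneq r 0) HC => [-> | rN0] HC.
    by case: C0 => s /HC; rewrite !mul0r.
  have rp : 0 < r by rewrite lt0r rN0.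
  rewrite mulrC -ler_pdivrMr //; apply: lb_le_inf => // s /HC.
  by rewrite ler_pdivrMr // mulrC.
rewrite mulrC; apply: (step) => //.
  by apply: lb_le_inf.
by move=> r Ar; rewrite mulrC; apply: (step) => // [|s Bs]; [exact: Ap | exact: H].
Qed.

(** Common tool for lower bounds of chains and for the two seminorms that test minimality: [U x]
    holds admissible bounds at [x], and its closure under sums and products passes to the infima. *)
Lemma inf_seminorm (n0 : M -> R) (U : M -> set R) :
  seminorm_below n0 -> (forall x, U x (n0 x)) ->
  (forall x r, U x r -> 0 <= r) ->
  (forall r, U 1 r -> 1 <= r) ->
  (forall x y r s, U x r -> U y s -> U (x + y) (r + s)) ->
  (forall x y r s, U x r -> U y s -> U (x * y) (r * s)) ->
  seminorm_below (fun x => inf (U x)) /\ forall x, inf (U x) <= n0 x.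
Proof.
move=> [n_ge0 n1 nD nM nq] U0 Uge0 U1 UD UM.
have Une x : (U x !=set0)%classic by exists (n0 x).
have lb x : has_lbound (U x) by exists 0 => r /Uge0.
have infle x r : U x r -> inf (U x) <= r by move=> Ur; apply: ge_inf.
split; last by move=> x; apply: infle.
split.
- by move=> x /=; apply: lb_le_inf => // r /Uge0.
- apply/eqP; rewrite eq_le /=; apply/andP; split; first by rewrite -n1; apply: infle.
  by apply: lb_le_inf.
- move=> x y /=; rewrite -lerBlDr; apply: lb_le_inf => // r Ur.
  rewrite lerBlDr [r + _]addrC -lerBlDr; apply: lb_le_inf => // s Us.
  by rewrite lerBlDr [s + _]addrC; apply: infle; apply: UD.
- move=> x y /=; apply: le_mul_inf => //; try exact: Uge0.
  by move=> r s Ur Us; apply: infle; apply: UM.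
- by move=> q /=; apply: le_trans (nq q); apply: infle.
Qed.

Lemma exists_minimal_seminorm (n0 : M -> R) : seminorm_below n0 ->
  exists n, seminorm_below n /\
    forall n', seminorm_below n' -> (forall x, n' x <= n x) -> n' = n.
Proof.
move=> P0; pose T := {n : M -> R | seminorm_below n}.
(* The order is reversed, so a maximal element in Zorn's lemma is a minimal seminorm. *)
pose le_ (s t : T) := `[< forall x, sval t x <= sval s x >].
have [||||n Hn] := @Zorn T le_.
- by move=> t; apply/asboolP => x.
- move=> r s t /asboolP rs /asboolP st; apply/asboolP => x.
  exact: le_trans (st x) (rs x).
- move=> [s Ps] [t Pt] /asboolP /= st /asboolP /= ts.
  by apply: eq_exist; apply: funext => x; apply/eqP; rewrite eq_le ts st.
- move=> A Atot.
  have [[n1 An1]|An] := pselect (A !=set0)%classic; last first.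
    by exists (exist _ n0 P0) => s As; case: An; exists s.
  (* Bounds reached along the chain; [dir] gives one member serving two bounds at once. *)
  pose U x : set R := fun r => exists2 n : T, A n & sval n x <= r.
  have dir s t : A s -> A t -> exists2 u : T, A u &
      forall x, sval u x <= sval s x /\ sval u x <= sval t x.
    move=> As At; case: (Atot s t As At) => /asboolP h.
      by exists t => // x; split=> //; apply: h.
    by exists s => // x; split=> //; apply: h.
  have [|||||Pinf _] := @inf_seminorm (sval n1) U (svalP n1).
  + by move=> x; exists n1.
  + by move=> x r [n _]; apply: le_trans; case: (svalP n) => + _ _ _ _; apply.
  + by move=> r [n _]; case: (svalP n) => _ -> _ _ _.
  + move=> x y r s [n An nr] [m Am ms]; have [u Au uH] := dir _ _ An Am.
    exists u => //; case: (svalP u) => _ _ uD _ _.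
    apply: le_trans (uD _ _) _; apply: lerD.
      by apply: le_trans nr; case: (uH x).
    by apply: le_trans ms; case: (uH y).
  + move=> x y r s [n An nr] [m Am ms]; have [u Au uH] := dir _ _ An Am.
    exists u => //; case: (svalP u) => u0 _ _ uM _.
    apply: le_trans (uM _ _) _; apply: ler_pM => //.
      by apply: le_trans nr; case: (uH x).
    by apply: le_trans ms; case: (uH y).
  exists (exist _ _ Pinf) => s As; apply/asboolP => x /=.
  apply: ge_inf; last by exists s.
  by exists 0 => r [n _]; apply: le_trans; case: (svalP n) => + _ _ _ _; apply.
exists (sval n); split; first exact: svalP.
move=> n' P' n'le.
by have /(congr1 (@sval _ _)) := Hn (exist _ n' P') (asboolT n'le).
Qed.

Section Minimal.
Variable n : M -> R.
Hypotheses (wA : absval w) (Pn : seminorm_below n).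
Hypothesis min_n : forall n', seminorm_below n' -> (forall x, n' x <= n x) -> n' = n.

Let n_ge0 x : 0 <= n x. Proof. by case: Pn. Qed.
Let n1 : n 1 = 1. Proof. by case: Pn. Qed.
Let nD x y : n (x + y) <= n x + n y. Proof. by case: Pn. Qed.
Let nM x y : n (x * y) <= n x * n y. Proof. by case: Pn. Qed.

Lemma seminorm_gt0 x : x != 0 -> 0 < n x.
Proof.
move=> xN0; rewrite lt0r n_ge0 andbT; apply/eqP => n0.
by have := nM x x^-1; rewrite mulfV // n1 n0 mul0r ler10.
Qed.

Lemma seminormX x i : n (x ^+ i) <= n x ^+ i.
Proof.
elim: i => [|i IH]; first by rewrite !expr0 n1.
by rewrite !exprS; apply: le_trans (nM _ _) _; apply: ler_wpM2l.
Qed.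


Let n0 : n 0 = 0.
Proof.
apply/eqP; rewrite eq_le n_ge0 andbT.
have [_ /(_ 0) [_ w0] _ _] := wA; rewrite -w0 //.
by case: Pn => _ _ _ _ /(_ 0); rewrite scale0r.
Qed.

Lemma seminorm_sum (I : Type) (r : seq I) (F : I -> M) :
  n (\sum_(i <- r) F i) <= \sum_(i <- r) n (F i).
Proof.
elim/big_ind2: _ => [|x1 x2 y1 y2 h1 h2|//]; first by rewrite n0.
by apply: le_trans (nD _ _) _; apply: lerD.
Qed.

Lemma seminorm_mulrn x i : n (x *+ i) <= n x *+ i.
Proof.
elim: i => [|i IH]; first by rewrite !mulr0n n0.
by rewrite !mulrS; apply: le_trans (nD _ _) _; apply: lerD.
Qed.

(* [n] dominates its spectral radius, which is again a seminorm. *)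
Lemma minimal_seminorm_sqr x : n (x ^+ 2) = n x ^+ 2.
Proof.
apply/eqP; rewrite eq_le seminormX /=.
(* The rates [r] with n(x^i) = O(r^i); their infimum is the spectral radius. *)
pose U (x : M) : set R := fun r =>
  0 <= r /\ exists C, forall i, n (x ^+ i) <= C * r ^+ i.
have C_ge0 y r C : (forall i, n (y ^+ i) <= C * r ^+ i) -> 0 <= C.
  by move/(_ 0); rewrite !expr0 n1 mulr1; apply: le_trans.
have [||||| /min_n En nle] := @inf_seminorm n U Pn.
- move=> y; split => //; exists 1 => i; rewrite mul1r; exact: seminormX.
- by move=> y r [].
- move=> r [r0 [C HC]]; rewrite leNgt; apply/negP => r1.
  have Cp : 0 < C by have := HC 0; rewrite expr1n n1 expr0 mulr1; apply: lt_le_trans.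
  have [i] : exists i, C * r ^+ i < 1.
    have Cip : 0 < C^-1 by rewrite invr_gt0.
    have [i Hi] := expr_lt_small r0 r1 Cip.
    by exists i; rewrite -ltr_pdivlMl // mulr1.
  by have := HC i; rewrite expr1n n1 => /le_lt_trans h /h; rewrite ltxx.
- move=> y z r s [r0 [C HC]] [s0 [D HD]]; split; first exact: addr_ge0.
  exists (C * D) => i; rewrite exprDn; apply: le_trans (seminorm_sum _ _) _.
  rewrite exprDn mulr_sumr; apply: ler_sum => j _.
  apply: le_trans (seminorm_mulrn _ _) _; rewrite mulrnAr lerMn2r; apply/orP; right.
  apply: le_trans (nM _ _) _; rewrite mulrACA.
  by apply: ler_pM.
- move=> y z r s [r0 [C HC]] [s0 [D HD]]; split; first exact: mulr_ge0.
  exists (C * D) => i; rewrite !exprMn; apply: le_trans (nM _ _) _.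
  by rewrite mulrACA; apply: ler_pM.
have {}En := congr1 (fun f => f x) (En nle).
have [->|xN0] := eqVneq x 0; first by rewrite expr0n n0 expr0n.
have x2p : 0 < n (x ^+ 2) by apply: seminorm_gt0; rewrite expf_neq0.
rewrite -[leRHS]sqr_sqrtr // ler_sqr ?nnegrE ?sqrtr_ge0 // -En.
set r := Num.sqrt _; have rp : 0 < r by rewrite sqrtr_gt0.
apply: ge_inf; first by exists 0 => s [].
split; first exact: ltW.
(* Powers of x^2 take care of the even part of [i]; the constant absorbs the factor [x] left over
   when [i] is odd. *)
exists (1 + n x / r) => i; rewrite -{1}(odd_double_half i) exprD -mul2n exprM.
apply: le_trans (nM _ _) _.
have h : n ((x ^+ 2) ^+ i./2) <= r ^+ (i./2).*2.
  by rewrite -mul2n exprM sqr_sqrtr //; apply: seminormX.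
have -> : r ^+ i = r ^+ odd i * r ^+ (i./2).*2 by rewrite -exprD odd_double_half.
rewrite mulrA; apply: ler_pM => //.
case: (odd i); rewrite ?expr0 ?expr1 /=.
  by rewrite mulrDl mul1r divfK ?gt_eqF // lerDr ltW.
by rewrite n1 mulr1 lerDl divr_ge0 // ltW.
Qed.

(** Equality at the exponent 2^i, obtained by squaring, forces it at [i], because n(x)^(2^i) <=
    n(x^i) n(x)^(2^i - i). *)
Lemma minimal_seminormX x i : n (x ^+ i) = n x ^+ i.
Proof.
apply/eqP; rewrite eq_le seminormX /=.
have [->|xN0] := eqVneq x 0; first by case: i => [|i]; rewrite ?expr0 ?n1 // !exprS !mul0r n0 mul0r.
have p2 j : n (x ^+ (2 ^ j)) = n x ^+ (2 ^ j).
  by elim: j => [|j IH]; rewrite ?expr1 // expnS mulnC !exprM minimal_seminorm_sqr IH.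
have ile : (i <= 2 ^ i)%N by apply/ltnW/ltn_expl.
have np := seminorm_gt0 xN0.
have := p2 i; rewrite -(subnKC ile) !exprD => E.
rewrite -(ler_pM2r (exprn_gt0 (2 ^ i - i) np)) -E.
by apply: le_trans (nM _ _) _; apply: ler_wpM2l => //; apply: seminormX.
Qed.

(* [n] dominates the seminorm [inf_i n (z x^i) / n x ^ i]. *)
Lemma minimal_seminormM x y : n (x * y) = n x * n y.
Proof.
have [->|xN0] := eqVneq x 0; first by rewrite mul0r n0 mul0r.
have np := seminorm_gt0 xN0.
have npX i : 0 < n x ^+ i by apply: exprn_gt0.
pose U (z : M) : set R := fun r => exists i, n (z * x ^+ i) <= r * n x ^+ i.
(* A bound at one exponent persists at larger ones, so two bounds can be brought to a common
   exponent. *)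
have up z r i j : n (z * x ^+ i) <= r * n x ^+ i -> (i <= j)%N ->
    n (z * x ^+ j) <= r * n x ^+ j.
  move=> h /subnKC <-; rewrite !exprD !mulrA; apply: le_trans (nM _ _) _.
  by apply: ler_pM => //; apply: seminormX.
have [||||| /min_n En nle] := @inf_seminorm n U Pn.
- by move=> z; exists 0; rewrite !expr0 !mulr1.
- by move=> z r [i h]; rewrite -(pmulr_lge0 _ (npX i)); apply: le_trans h.
- by move=> r [i]; rewrite mul1r minimal_seminormX -{1}[n x ^+ i]mul1r ler_pM2r.
- move=> z z' r s [i hi] [j hj]; exists (maxn i j); rewrite !mulrDl.
  apply: le_trans (nD _ _) _; apply: lerD.
    exact: up hi (leq_maxl _ _).
  exact: up hj (leq_maxr _ _).
- move=> z z' r s [i hi] [j hj]; exists (i + j)%N; rewrite !exprD mulrACA.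
  by apply: le_trans (nM _ _) _; rewrite mulrACA; apply: ler_pM.
have {}En z := congr1 (fun f => f z) (En nle).
apply/eqP; rewrite eq_le nM /= -(En y) -ler_pdivlMl // mulrC.
(* The exponent 1 puts [n (x * y) / n x] into [U y]. *)
apply: ge_inf; last by exists 1; rewrite !expr1 divfK ?gt_eqF // mulrC.
by exists 0 => r [i h]; rewrite -(pmulr_lge0 _ (npX i)); apply: le_trans h.
Qed.

(** On Q the reverse inequality comes from 1 = n(q q^-1) <= n(q) w(q^-1). *)
Lemma minimal_seminorm_absval : absval n /\ forall q : rat, n q%:A = w q.
Proof.
split.
  split=> //; last exact: minimal_seminormM.
  move=> x; split=> [nx0|->//]; apply/eqP/negP => /negP /seminorm_gt0.
  by rewrite nx0 ltxx.
case: wA Pn => w_ge0 w0 wM _ [_ _ _ _ nq] q.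
have [->|qN0] := eqVneq q 0; first by rewrite scale0r n0; apply/esym/w0.
have w1 : w 1 = 1.
  have : w 1 != 0 by apply/eqP => /w0 /eqP; rewrite oner_eq0.
  by move/mulfI; apply; rewrite -wM !mulr1.
apply/eqP; rewrite eq_le nq /=.
have np : 0 < n q%:A.
  by apply: seminorm_gt0; rewrite scaler_eq0 negb_or qN0 oner_neq0.
have wp : 0 < w q^-1.
  by rewrite lt0r w_ge0 andbT; apply/eqP => /w0/eqP; rewrite invr_eq0 (negbTE qN0).
rewrite -(ler_pM2r wp) -wM divff // w1.
have <- : n (q%:A * q^-1%:A) = 1.
  by rewrite -scalerAl mul1r scalerA divff // scale1r.
by apply: le_trans (nM _ _) _; apply: ler_wpM2l.
Qed.

End Minimal.
End Seminorms.

(** * Absolute values and their extension to number fields *)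

Section AbsvalTheory.
Variables (R : realType) (F : fieldType) (a : F -> R).
Hypothesis aA : absval a.

Lemma absval_ge0 x : 0 <= a x. Proof. by case: aA. Qed.
Lemma absvalM x y : a (x * y) = a x * a y. Proof. by case: aA. Qed.
Lemma absvalD x y : a (x + y) <= a x + a y. Proof. by case: aA. Qed.
Lemma absval_eq0 x : (a x == 0) = (x == 0).
Proof. by case: aA => _ a0 _ _; apply/eqP/eqP => /a0. Qed.
Lemma absval0 : a 0 = 0. Proof. by apply/eqP; rewrite absval_eq0. Qed.
Lemma absval_gt0 x : (0 < a x) = (x != 0).
Proof. by rewrite lt0r absval_ge0 andbT absval_eq0. Qed.
Lemma absval1 : a 1 = 1.
Proof.
have : a 1 != 0 by rewrite absval_eq0 oner_neq0.
by move/mulfI; apply; rewrite -absvalM !mulr1.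
Qed.
Lemma absvalX x i : a (x ^+ i) = a x ^+ i.
Proof. by elim: i => [|i IH]; rewrite ?expr0 ?absval1 // !exprS absvalM IH. Qed.
Lemma absvalN1 : a (-1) = 1.
Proof.
apply/eqP; rewrite -(@eqrXn2 _ 2) ?absval_ge0 ?ler01 // -absvalX sqrrN !expr1n.
by rewrite absval1.
Qed.
Lemma absvalN x : a (- x) = a x.
Proof. by rewrite -mulN1r absvalM absvalN1 mul1r. Qed.
Lemma absvalB x y : a (x - y) <= a x + a y.
Proof. by rewrite -[a y]absvalN; apply: absvalD. Qed.
Lemma absvalBC x y : a (x - y) = a (y - x).
Proof. by rewrite -absvalN opprB. Qed.
Lemma absvalV x : a x^-1 = (a x)^-1.
Proof.
have [->|xN0] := eqVneq x 0; first by rewrite invr0 absval0 invr0.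
have aN0 : a x != 0 by rewrite absval_eq0.
by apply: (mulfI aN0); rewrite -absvalM !mulfV // absval1.
Qed.
Lemma absval_sum (I : Type) (r : seq I) (P : pred I) (G : I -> F) :
  a (\sum_(i <- r | P i) G i) <= \sum_(i <- r | P i) a (G i).
Proof.
elim/big_ind2: _ => [|x1 x2 y1 y2 h1 h2|//]; first by rewrite absval0.
by apply: le_trans (absvalD _ _) _; apply: lerD.
Qed.
Lemma absval_prod (I : Type) (r : seq I) (P : pred I) (G : I -> F) :
  a (\prod_(i <- r | P i) G i) = \prod_(i <- r | P i) a (G i).
Proof. by apply: (big_morph a absvalM absval1). Qed.
End AbsvalTheory.

(** * The regular representation of a number field over Q *)

Section RegularRepresentation.
Variable M : fieldExtType rat.
Let e := vbasis {:M}.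

(** The images of the basis vectors are the rows; the determinant is the norm of [x] down to Q. *)
Definition mulmat (x : M) : 'M[rat]_(\dim {:M}) := \matrix_(i, j) coord e j (e`_i * x).

Lemma mulmatE x (i : 'I_(\dim {:M})) : e`_i * x = \sum_j mulmat x i j *: e`_j.
Proof.
rewrite {1}(coord_vbasis (memvf (e`_i * x))).
by apply: eq_bigr => j _; rewrite mxE.
Qed.

Lemma mulmat_inj x (A : 'M[rat]_(\dim {:M})) :
  (forall i : 'I_(\dim {:M}), e`_i * x = \sum_j A i j *: e`_j) -> mulmat x = A.
Proof.
move=> H; apply/matrixP => i j; rewrite mxE H.
by rewrite coord_sum_free //; apply: basis_free; apply: vbasisP.
Qed.

Lemma mulmat1 : mulmat 1 = 1%:M.
Proof.
apply: mulmat_inj => i; rewrite mulr1 (bigD1 i) //= mxE eqxx scale1r big1 ?addr0 //.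
by move=> j ji; rewrite mxE eq_sym (negbTE ji) scale0r.
Qed.

Lemma mulmatM x y : mulmat (x * y) = mulmat x *m mulmat y.
Proof.
apply: mulmat_inj => i; rewrite mulrA mulmatE mulr_suml.
under eq_bigr => j _ do rewrite -scalerAl mulmatE scaler_sumr.
rewrite exchange_big /=; apply: eq_bigr => l _.
by rewrite mxE scaler_suml; apply: eq_bigr => j _; rewrite scalerA.
Qed.

Lemma mulmatZ q : mulmat q%:A = q%:M.
Proof.
apply: mulmat_inj => i; rewrite -scalerAr mulr1 (bigD1 i) //= mxE eqxx mulr1n big1 ?addr0 //.
by move=> j ji; rewrite mxE eq_sym (negbTE ji) scale0r.
Qed.

Lemma mulmatD x y : mulmat (x + y) = mulmat x + mulmat y.
Proof.
apply: mulmat_inj => i; rewrite mulrDr !mulmatE -big_split.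
by apply: eq_bigr => j _; rewrite [(mulmat x + _) i j]mxE scalerDl.
Qed.

End RegularRepresentation.

(** * Extension of an absolute value of Q to a number field *)

Section Existence.
Variables (R : realType) (M : fieldExtType rat) (w : rat -> R).
Hypothesis wA : absval w.

Let row_sum (A : 'M[rat]_(\dim {:M})) i := \sum_j w (A i j).
Let opnorm (x : M) : R := \big[Num.max/0]_i row_sum (mulmat x) i.

Let row_sum_ge0 A i : 0 <= row_sum A i.
Proof. by apply: sumr_ge0 => j _; apply: absval_ge0. Qed.

Let row_sum_le x i : row_sum (mulmat x) i <= opnorm x.
Proof. exact: le_bigmax. Qed.

Let opnorm_ge0 x : 0 <= opnorm x. Proof. exact: bigmax_ge_id. Qed.

Let opnormZ q : opnorm q%:A = w q.
Proof.
have D0 : (0 < \dim {:M})%N by apply: (adim_gt0 (aspacef M)).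
have E i : row_sum (mulmat q%:A) i = w q.
  rewrite /row_sum mulmatZ (bigD1 i) //= mxE eqxx mulr1n big1 ?addr0 // => j ji.
  by rewrite mxE eq_sym (negbTE ji) absval0.
apply/eqP; rewrite eq_le; apply/andP; split.
  by apply: bigmax_le => [|i _]; rewrite ?absval_ge0 // E.
by rewrite -(E (Ordinal D0)) row_sum_le.
Qed.

(** The maximal row sum of a matrix is submultiplicative, as an operator norm for the maximum norm
    is. It provides the seminorm from which a minimal one is reached. *)
Lemma opnorm_seminorm : seminorm_below w opnorm.
Proof.
split=> //.
- by rewrite -(scale1r (1 : M)) opnormZ (absval1 wA).
- move=> x y; apply: bigmax_le => [|i _]; first exact: addr_ge0.
  rewrite /row_sum mulmatD; apply: le_trans (lerD (row_sum_le x i) (row_sum_le y i)).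
  by rewrite -big_split; apply: ler_sum => j _; rewrite mxE; apply: absvalD.
- move=> x y; apply: bigmax_le => [|i _]; first exact: mulr_ge0.
  apply: (@le_trans _ _ (\sum_j w (mulmat x i j) * row_sum (mulmat y) j)).
    rewrite /row_sum mulmatM.
    under [leRHS]eq_bigr => j _ do rewrite mulr_sumr.
    rewrite exchange_big; apply: ler_sum => l _; rewrite mxE.
    apply: le_trans (absval_sum wA _ _ _) _.
    by apply: ler_sum => j _; rewrite (absvalM wA).
  apply: (@le_trans _ _ (\sum_j w (mulmat x i j) * opnorm y)).
    by apply: ler_sum => j _; apply: ler_wpM2l; rewrite ?absval_ge0.
  by rewrite -mulr_suml; apply: ler_wpM2r => //; apply: row_sum_le.
- by move=> q; rewrite opnormZ.
Qed.

Lemma exists_absval_over : exists b : M -> R, absval b /\ forall q : rat, b q%:A = w q.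
Proof.
have [n [Pn min_n]] := exists_minimal_seminorm opnorm_seminorm.
by exists n; apply: minimal_seminorm_absval.
Qed.
End Existence.

(** * Weak approximation *)

Definition evtl (P : nat -> Prop) := exists i, forall j, (i <= j)%N -> P j.

Lemma evtl_and P Q : evtl P -> evtl Q -> evtl (fun i => P i /\ Q i).
Proof.
move=> [i Hi] [j Hj]; exists (maxn i j) => l; rewrite geq_max => /andP[il jl].
by split; [apply: Hi | apply: Hj].
Qed.

Lemma evtl_imp (P Q : nat -> Prop) : (forall i, P i -> Q i) -> evtl P -> evtl Q.
Proof. by move=> PQ [i Hi]; exists i => j /Hi /PQ. Qed.

Lemma evtl_all (T : eqType) (s : seq T) (P : T -> nat -> Prop) :
  (forall x, x \in s -> evtl (P x)) -> evtl (fun i => forall x, x \in s -> P x i).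
Proof.
elim: s => [|x s IH] H; first by exists 0%N.
have [||i Hi] := @evtl_and (P x) (fun i => forall y, y \in s -> P y i).
- by apply: H; rewrite mem_head.
- by apply: IH => y ys; apply: H; rewrite in_cons ys orbT.
exists i => j /Hi [Px Ps] y; rewrite in_cons => /orP[/eqP->//|]; exact: Ps.
Qed.

Lemma evtl_expr_lt (R : realType) (x e : R) : 0 <= x -> x < 1 -> 0 < e ->
  evtl (fun i => x ^+ i < e).
Proof.
move=> x0 x1 /(expr_lt_small x0 x1)[i Hi]; exists i => j ij.
by apply: le_lt_trans Hi; apply: ler_wiXn2l => //; apply: ltW.
Qed.

Section WeakApproximation.
Variables (R : realType) (k : fieldExtType rat) (w : rat -> R).

Definition place_over (a : k -> R) : Prop := absval a /\ forall q : rat, a q%:A = w q.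

Hypotheses (wA : absval w) (w_nontriv : exists q : rat, q != 0 /\ w q < 1).

(** A high power of [x] makes the ratio of [a] to [b] less than [w q], and a power of [q] brings [b]
    below 1. Some power of [q] then has its absolute value strictly between the two values, and
    dividing by it separates them. *)
Lemma separate_lt (a b : k -> R) x : place_over a -> place_over b -> a x < b x ->
  exists y, a y < 1 /\ 1 < b y.
Proof.
move=> [aA aw] [bA bw] ab.
have [q [qN0 q1]] := w_nontriv.
have qp : 0 < w q by rewrite absval_gt0.
have bp : 0 < b x by apply: le_lt_trans ab; apply: (absval_ge0 aA).
have [n Hn] : exists n, (a x / b x) ^+ n < w q.
  apply: expr_lt_small => //; first by rewrite divr_ge0 ?(absval_ge0 aA) // ltW.
  by rewrite ltr_pdivrMr // mul1r.
have bnp : 0 < b (x ^+ n) by rewrite (absvalX bA) exprn_gt0.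
have abn : a (x ^+ n) < w q * b (x ^+ n).
  by rewrite -ltr_pdivrMr // (absvalX aA) (absvalX bA) -expr_div_n.
have bVp : 0 < (b (x ^+ n))^-1 by rewrite invr_gt0.
have [M HM] := expr_lt_small (ltW qp) q1 bVp.
pose z := x ^+ n * (q%:A) ^+ M.
have az : a z < w q * b z.
  by rewrite (absvalM aA) (absvalM bA) (absvalX aA (q%:A)) (absvalX bA (q%:A)) aw bw mulrA ltr_pM2r // exprn_gt0.
have bz1 : b z < 1.
  by rewrite (absvalM bA) (absvalX bA (q%:A)) bw -ltr_pdivlMl // mulr1.
have bz0 : 0 < b z by rewrite (absvalM bA) (absvalX bA (q%:A)) bw mulr_gt0 // exprn_gt0.
(* For the least such exponent [m.+1], a(z) < w(q) b(z) <= w(q)^(m+1) < b(z). *)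
have exm : exists m, w q ^+ m < b z by apply: expr_lt_small => //; apply: ltW.
case: (ex_minnP exm) => -[|m]; first by rewrite expr0 ltNge (ltW bz1).
move=> Hm mmin.
have {mmin} bzm : b z <= w q ^+ m by rewrite leNgt; apply/negP => /mmin; rewrite ltnn.
have wmp : 0 < w q ^+ m.+1 by rewrite exprn_gt0.
exists (z / (q%:A) ^+ m.+1).
rewrite (absvalM aA) (absvalM bA) (absvalV aA) (absvalV bA) (absvalX aA) (absvalX bA) aw bw; split; last by rewrite ltr_pdivlMr ?mul1r.
rewrite ltr_pdivrMr // mul1r; apply: lt_le_trans az _.
by rewrite exprS ler_pM2l.
Qed.

(** If the values compare the other way round, the two places are exchanged and the result is
    inverted. *)
Lemma separate (a b : k -> R) : place_over a -> place_over b -> a <> b ->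
  exists y, a y < 1 /\ 1 < b y.
Proof.
move=> aw bw ab.
have [x xab] : exists x, a x != b x.
  apply: contrapT => H; apply: ab; apply: funext => x; apply/eqP/negP => /negP ?.
  by apply: H; exists x.
have [ltab|ltba|E] := ltgtP (a x) (b x); last by rewrite E eqxx in xab.
  exact: separate_lt ltab.
have [y [by1 ay1]] := separate_lt bw aw ltba.
have [aA _] := aw; have [bA _] := bw.
exists y^-1; rewrite (absvalV aA) (absvalV bA); split; first by rewrite invf_lt1 // (lt_trans ltr01).
have bp : 0 < b y.
  rewrite (absval_gt0 bA); apply: contraTneq ay1 => ->.
  by rewrite (absval0 aA) ltNge ler01.
by rewrite invf_gt1.
Qed.

(** The elements x^i / (1 + x^i) tend to 0 where |x| < 1 and, by [evtl_near1], to 1 where |x| >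
    1. *)
Lemma evtl_small (a : k -> R) x e : absval a -> a x < 1 -> 0 < e ->
  evtl (fun i => 1 + x ^+ i != 0 /\ a (x ^+ i / (1 + x ^+ i)) < e).
Proof.
move=> aA ax e0.
(* Once a(x^i) < 1/2 the denominator exceeds 1/2, so a(x^i) < e/2 is enough. *)
have e' : 0 < Num.min (2^-1) (e / 2) :> R by rewrite lt_min divr_gt0 // invr_gt0 ltr0n.
apply: evtl_imp (evtl_expr_lt (absval_ge0 aA x) ax e') => i.
rewrite lt_min -(absvalX aA) => /andP[h1 h2].
have h3 : 2^-1 < a (1 + x ^+ i).
  have : a 1 <= a (1 + x ^+ i) + a (x ^+ i).
    by rewrite -{1}[1](addrK (x ^+ i)) (absvalB aA).
  rewrite (absval1 aA); lra.
have h4 : 0 < a (1 + x ^+ i) by apply: lt_trans h3; rewrite invr_gt0 ltr0n.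
split; first by rewrite -(absval_eq0 aA) gt_eqF.
rewrite (absvalM aA) (absvalV aA) ltr_pdivrMr //; nra.
Qed.

Lemma evtl_near1 (a : k -> R) x e : absval a -> 1 < a x -> 0 < e ->
  evtl (fun i => a (x ^+ i / (1 + x ^+ i) - 1) < e).
Proof.
move=> aA ax e0.
have ax0 : 0 < a x by apply: lt_trans ax; exact: ltr01.
have xN0 : x != 0 by rewrite -(absval_gt0 aA).
have axV : a x^-1 < 1 by rewrite (absvalV aA) invf_lt1.
apply: evtl_imp (evtl_small aA axV e0) => i [vN0]; rewrite exprVn in vN0 *.
suff -> : x ^+ i / (1 + x ^+ i) - 1 = - ((x ^+ i)^-1 / (1 + (x ^+ i)^-1)).
  by rewrite (absvalN aA).
have xiN0 : x ^+ i != 0 by rewrite expf_neq0.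
have H : 1 + x ^+ i != 0.
  apply: contraNneq vN0 => h.
  by rewrite -[1 in X in X + _](mulfV xiN0) -{2}[(x ^+ i)^-1]mul1r -mulrDl addrC h mul0r.
have H' : x ^+ i + 1 != 0 by rewrite addrC.
by field; rewrite xiN0 H'.
Qed.

(** Induction on the list: [x] serves the tail and [y] separates [a0] from the new place [a']. If
    [a' x <= 1], take x^i y with [i] large. Otherwise replace x^i by x^i / (1 + x^i), which is near
    1 at both [a0] and [a'] and near 0 on the tail. *)
Lemma exists_dominated (a0 : k -> R) (s : seq (k -> R)) : place_over a0 ->
  (forall a, a \in s -> place_over a) -> a0 \notin s ->
  exists x, 1 < a0 x /\ forall a, a \in s -> a x < 1.
Proof.
move=> p0; have [a0A _] := p0.
elim: s => [|a' s IH] Hs a0s.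
  have [q [qN0 q1]] := w_nontriv; exists (q%:A)^-1; split=> //.
  have qp : 0 < w q by rewrite absval_gt0.
  by rewrite (absvalV a0A) p0.2 invf_gt1.
move: a0s; rewrite in_cons negb_or => /andP[a0a' a0s].
have Hs' a : a \in s -> place_over a by move=> h; apply: Hs; rewrite in_cons h orbT.
have p' : place_over a' by apply: Hs; rewrite mem_head.
have a'A := p'.1.
have [x [x0 xs]] := IH Hs' a0s.
have [y [y' y0]] := separate p' p0 (fun E => negP a0a' (introT eqP (esym E))).
have [x'1 | x'1] := leP (a' x) 1.
  have [i Hi] : evtl (fun i => forall a, a \in s -> (a x) ^+ i < (1 + a y)^-1).
    apply: evtl_all => a as_; have [aA _] := Hs' a as_.
    apply: evtl_expr_lt; rewrite ?(absval_ge0 aA) ?xs //.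
    by rewrite invr_gt0 ltr_pwDl // (absval_ge0 aA).
  exists (x ^+ i * y); split.
    rewrite (absvalM a0A) (absvalX a0A); apply: lt_le_trans y0 _.
    by rewrite ler_peMl ?(absval_ge0 a0A) // exprn_ege1 // ltW.
  move=> a; rewrite in_cons => /orP[/eqP ->|as_].
    rewrite (absvalM a'A) (absvalX a'A); apply: le_lt_trans y'.
    by rewrite ler_piMl ?(absval_ge0 a'A) // exprn_ile1 // (absval_ge0 a'A).
  have [aA _] := Hs' a as_.
  have y1 : 0 < 1 + a y by rewrite ltr_pwDl // (absval_ge0 aA).
  rewrite (absvalM aA) (absvalX aA); have := Hi i (leqnn _) a as_.
  rewrite -(ltr_pM2r y1) mulVf ?gt_eqF //; apply: le_lt_trans.
  by apply: ler_wpM2l; rewrite ?exprn_ge0 ?(absval_ge0 aA) // lerDr.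
have y0p : 0 < a0 y by apply: lt_trans y0.
(* The margins are chosen so that a0(y) (1 - e0) = 1 and a'(y) (1 + e') = 1 - (1 - a'(y))^2 < 1. *)
pose e0 := 1 - (a0 y)^-1.
have e0p : 0 < e0 by rewrite subr_gt0 invf_lt1.
pose e' := 1 - a' y.
have e'p : 0 < e' by rewrite subr_gt0.
have ev_s : evtl (fun i => forall a, a \in s -> 
    a (x ^+ i / (1 + x ^+ i)) < (1 + a y)^-1).
  apply: evtl_all => a as_; have [aA _] := Hs' a as_.
  have h : 0 < (1 + a y)^-1 by rewrite invr_gt0 ltr_pwDl // (absval_ge0 aA).
  by apply: evtl_imp (evtl_small aA (xs a as_) h) => i [].
have [i Hi] := evtl_and ev_s (evtl_and (evtl_near1 a0A x0 e0p) (evtl_near1 a'A x'1 e'p)).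
have {Hi} [Hs1 [H0 H1]] := Hi i (leqnn i).
set z := x ^+ i / (1 + x ^+ i) in Hs1 H0 H1.
exists (z * y); split.
  have h : a0 y <= a0 (z * y) + a0 ((z - 1) * y).
    by rewrite -{1}[y](_ : z * y - (z - 1) * y = _) ?(absvalB a0A) //; ring.
  rewrite [a0 (_ * y) in X in _ + X](absvalM a0A) in h.
  have h2 : a0 (z - 1) * a0 y < a0 y - 1.
    have -> : a0 y - 1 = e0 * a0 y by rewrite mulrBl mul1r mulVf // gt_eqF.
    by rewrite ltr_pM2r.
  lra.
move=> a; rewrite in_cons => /orP[/eqP ->|as_].
  have h : a' (z * y) <= a' y + a' ((z - 1) * y).
    by rewrite -{1}(_ : y + (z - 1) * y = z * y) ?(absvalD a'A) //; ring.
  rewrite [a' (_ * y) in X in _ + X](absvalM a'A) in h.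
  have := absval_ge0 a'A y; have := absval_ge0 a'A (z - 1).
  rewrite /e' in H1; nra.
have [aA _] := Hs' a as_.
have y1 : 0 < 1 + a y by rewrite ltr_pwDl // (absval_ge0 aA).
rewrite (absvalM aA); have := Hs1 a as_.
rewrite -(ltr_pM2r y1) mulVf ?gt_eqF //; apply: le_lt_trans.
by apply: ler_wpM2l; rewrite ?(absval_ge0 aA) // lerDr.
Qed.

Lemma weak_approximation (a0 : k -> R) (s : seq (k -> R)) e : place_over a0 ->
  (forall a, a \in s -> place_over a) -> a0 \notin s -> 0 < e ->
  exists y, a0 (y - 1) < e /\ forall a, a \in s -> a y < e.
Proof.
move=> p0 Hs a0s e0; have [x [x0 xs]] := exists_dominated p0 Hs a0s.
have ev_s : evtl (fun i => forall a, a \in s -> a (x ^+ i / (1 + x ^+ i)) < e).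
  apply: evtl_all => a as_; have [aA _] := Hs a as_.
  by apply: evtl_imp (evtl_small aA (xs a as_) e0) => i [].
have [i Hi] := evtl_and ev_s (evtl_near1 p0.1 x0 e0).
by have [h1 h2] := Hi i (leqnn i); exists (x ^+ i / (1 + x ^+ i)).
Qed.

End WeakApproximation.

(** * The sum of the local degrees *)

(** The fibres of [g] are finitely many pieces of small diameter covering the unit ball; this stands
    in for compactness of the unit ball of the completion. *)
Definition totally_bounded (R : realType) (w : rat -> R) : Prop :=
  forall e, 0 < e -> exists (T : finType) (g : rat -> T),
    forall p q, w p <= 1 -> w q <= 1 -> g p = g q -> w (p - q) < e.

Lemma linear_dependence (k : fieldExtType rat) (J : finType) (z : J -> k) :
  (\dim {:k} < #|J|)%N -> exists q : J -> rat, (exists j, q j != 0) /\ \sum_j q j *: z j = 0.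
Proof.
move=> ltdJ; pose X := [tuple z (enum_val i) | i < #|J|].
have : ~~ free X.
  apply: contraL ltdJ => freeX; rewrite -leqNgt -{1}(size_tuple X) -(eqnP freeX).
  by apply/dimvS/subvf.
move/freeP => H; apply: contrapT => nq; apply: H => c c0 i; apply/eqP/negP => /negP ciN0.
apply: nq; exists (fun j => c (enum_rank j)); split; first by exists (enum_val i); rewrite enum_valK.
rewrite -[RHS]c0 (reindex (@enum_val J J)) /=; last exact/onW_bij/enum_val_bij.
by apply: eq_bigr => j _; rewrite enum_valK -(tnth_mktuple (fun i => z (enum_val i)) j) (tnth_nth 0).
Qed.

Section LocalDegree.
Variables (R : realType) (k : fieldExtType rat) (w : rat -> R).
Hypotheses (wA : absval w) (w_nontriv : exists q : rat, q != 0 /\ w q < 1).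
Hypothesis w_tb : totally_bounded w.

(** Sequential compactness without a completion: if normalised coefficients gave arbitrarily small
    combinations, repeated refinement would extract Cauchy coefficients violating independence. *)
Lemma local_indep_bound (a : k -> R) m (x : 'I_m -> k) :
  place_over w a -> local_indep a x ->
  exists2 d : R, 0 < d & forall q : 'I_m -> rat, (forall i, w (q i) <= 1) ->
    (exists i, q i = 1) -> d <= a (\sum_i q i *: x i).
Proof.
move=> [aA aw] Hx; apply: contrapT => Hd; apply: Hx.
pose f (q : 'I_m -> rat) := a (\sum_i q i *: x i).
pose X : set ('I_m -> rat) := fun q => (forall i, w (q i) <= 1) /\ exists i, q i = 1.
pose good (S : set ('I_m -> rat)) :=
  (forall q, S q -> X q) /\ forall d, 0 < d -> exists2 q, S q & f q < d.
have goodX : good X.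
  split=> // d d0; apply: contrapT => Hq; apply: Hd; exists d => // q q1 q2.
  by rewrite leNgt; apply/negP => lt; apply: Hq; exists q.
(* Pigeonhole: a good set is cut into finitely many pieces of diameter below 2^-e, one of which is
   still good. A set that is not good is returned unchanged, so that [choice] gives a total
   function. *)
have refine (Se : set ('I_m -> rat) * nat) : exists S' : set ('I_m -> rat), good Se.1 ->
    good S' /\ (forall q, S' q -> Se.1 q) /\
    forall p q, S' p -> S' q -> forall i, w (p i - q i) < 2^-1 ^+ Se.2.
  case: Se => S e /=; have [[SX S0]|ngood] := pselect (good S); last by exists S.
  have e0 : 0 < 2^-1 ^+ e :> R by rewrite exprn_gt0 // invr_gt0 ltr0n.
  have [T [g Hg]] := w_tb e0.
  pose G (q : 'I_m -> rat) : {ffun 'I_m -> T} := [ffun i => g (q i)].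
  suff [t Ht] : exists t, forall d, 0 < d -> exists2 q, S q /\ G q = t & f q < d.
    exists (fun q => S q /\ G q = t) => _; split; last first.
      split=> [q []//|p q [Sp Gp] [Sq Gq] i]; apply: Hg.
      - by case: (SX _ Sp).
      - by case: (SX _ Sq).
      - by have := congr1 (fun h : {ffun 'I_m -> T} => h i) (etrans Gp (esym Gq)); rewrite !ffunE.
    by split=> // q [/SX].
  apply: contrapT => nt.
  have /choice [d Hdt] t : exists d, 0 < d /\ forall q, S q -> G q = t -> d <= f q.
    apply: contrapT => nd; apply: nt; exists t => d d0.
    apply: contrapT => nq; apply: nd; exists d; split=> // q Sq Gq.
    by rewrite leNgt; apply/negP => lt; apply: nq; exists q.
  (* If each piece had a positive lower bound for [f], the least of these would be one for all of
     [S]. *)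
  have dp : 0 < \big[Num.min/1]_t d t.
    by apply: lt_bigmin => // t _; case: (Hdt t).
  have [q Sq] := S0 _ dp; rewrite ltNge => /negP; apply.
  by apply: le_trans (bigmin_le _ (G q) _) _; case: (Hdt (G q)) => _; apply.
have {refine} [step Hstep] := choice refine.
pose S := fix S n := if n is n'.+1 then step (S n', n') else X.
have goodS n : good (S n) by elim: n => [//|n IH]; case: (Hstep (S n, n) IH).
have Sdec n j : (n <= j)%N -> forall q, S j q -> S n q.
  move/subnKC <-; elim: (j - n)%N => [|i IH] q; first by rewrite addn0.
  by rewrite addnS /= => Sq; apply: IH; case: (Hstep (S (n + i)%N, (n + i)%N) (goodS _)) => _ [+ _]; apply.
have half n : 0 < 2^-1 ^+ n :> R by rewrite exprn_gt0 // invr_gt0 ltr0n.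
have half1 : 2^-1 < 1 :> R by rewrite invf_lt1 ?ltr0n // ltr1n.
have half0 : 0 <= 2^-1 :> R by rewrite invr_ge0 ler0n.
(* Diagonal choice in the nested sets makes the coefficients Cauchy. *)
have /choice [c Hc] n : exists q, S n q /\ f q < 2^-1 ^+ n.
  by case: (goodS n) => _ /(_ _ (half n)) [q Sq fq]; exists q.
exists (fun i n => c n i); split.
- move=> i e e0; have [N HN] := expr_lt_small half0 half1 e0.
  exists N.+1 => m1 n1 Nm Nn; rewrite aw; apply: lt_trans HN.
  case: (Hstep (S N, N) (goodS N)) => _ [_] /=; apply.
    exact: (Sdec N.+1 m1 Nm _ (Hc m1).1).
  exact: (Sdec N.+1 n1 Nn _ (Hc n1).1).
(* Every chosen vector has a coordinate equal to 1, so its finitely many coordinate sequences cannot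
   all be null. *)
- apply: contrapT => Hnull.
  have ev : evtl (fun n => forall i, i \in enum 'I_m -> w (c n i) < 1).
    apply: evtl_all => i _; apply: contrapT => ni; apply: Hnull; exists i => nul; apply: ni.
    by have [N HN] := nul 1 ltr01; exists N => n /HN; rewrite aw.
  have [N HN] := ev; case: (goodS N) => /(_ _ (Hc N).1) [_ [i ci]] _.
  by have := HN N (leqnn N) i (mem_enum _ _); rewrite ci (absval1 wA) ltxx.
- move=> e e0; have [N HN] := evtl_expr_lt half0 half1 e0.
  by exists N => n /HN; apply: lt_trans; case: (Hc n).
Qed.

Lemma local_degree_attained (a : k -> R) :
  exists x : 'I_(local_degree a) -> k, local_indep a x.
Proof.
rewrite /local_degree.
pose A := [pred m : 'I_(\dim {:k}).+1 | `[< exists x : 'I_m -> k, local_indep a x >]].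
have A0 : (0 < #|A|)%N.
  (* The empty family is independent, so the maximum runs over a nonempty set. *)
  apply/card_gt0P; exists ord0; apply: asboolT.
  exists (fun=> 0); move=> [c [_ [[i lt_i] _] _]]; by [].
by have [m /asboolP Hm ->] := eq_bigmax_cond (fun m : 'I_(\dim {:k}).+1 => m : nat) A0.
Qed.

(** Each maximal independent family at a place is multiplied by an element near 1 there and near 0
    at the other places. With more than [k : Q] members in all, there is a rational relation; read
    at the place of its largest coefficient, it contradicts the lower bound of
    [local_indep_bound]. *)
Lemma sum_local_degree_le (s : seq (k -> R)) : uniq s ->
  (forall a, a \in s -> place_over w a) ->
  (\sum_(a <- s) local_degree a <= \dim {:k})%N.
Proof.
move=> us Hs; rewrite leqNgt; apply/negP => ltd.
pose I := 'I_(size s); pose a (i : I) := tnth (in_tuple s) i.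
have aP i : place_over w (a i) by apply: Hs; apply: mem_tnth.
have aA i : absval (a i) by case: (aP i).
pose d i := local_degree (a i).
have /(_ _) /cid Hx i := local_degree_attained (a i).
pose x i := sval (Hx i); have xI i : local_indep (a i) (x i) := svalP (Hx i).
pose J : finType := {i : I & 'I_(d i)}.
have /choice [del Hdel] i : exists e : R, 0 < e /\ forall q : 'I_(d i) -> rat,
    (forall l, w (q l) <= 1) -> (exists l, q l = 1) -> e <= a i (\sum_l q l *: x i l).
  by have [e e0 He] := local_indep_bound (aP i) (xI i); exists e.
pose X (j : J) := x (tag j) (tagged j).
pose C i := \sum_(j : J) a i (X j).
have C0 i : 0 <= C i by apply: sumr_ge0 => j _; apply: absval_ge0.
(* This makes [e * C i < del i] at every place; the added 1 keeps the denominator positive. *)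
pose e : R := \big[Num.min/1]_i (del i / (C i + 1)).
have e0 : 0 < e.
  by apply: lt_bigmin => // i _; rewrite divr_gt0 //; [case: (Hdel i) | rewrite ltr_wpDl].
have /choice [y Hy] i : exists y, a i (y - 1) < e /\ forall i', i' != i -> a i' y < e.
  have [||y [y1 y2]] := @weak_approximation _ _ _ wA w_nontriv (a i) (rem (a i) s) e (aP i) _ _ e0.
  - by move=> b /mem_rem; apply: Hs.
  - by rewrite mem_rem_uniq // inE eqxx.
  exists y; split=> // i' ii'; apply: y2; rewrite mem_rem_uniq // inE mem_tnth andbT.
  by rewrite /a !(tnth_nth 0) /= nth_uniq.
have cardJ : (\dim {:k} < #|J|)%N.
  rewrite card_tagged sumnE big_map big_enum /=.
  by under eq_bigr => i _ do rewrite card_ord; rewrite /d (big_tnth _ _ s) in ltd *.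
have [q [[j1 qj1] Hq]] := linear_dependence (fun j : J => y (tag j) * X j) cardJ.
(* Division by the largest coefficient leaves all coefficients in the unit ball and one equal to
   1. *)
have [j0 _ j0max] := @arg_maxP _ _ J j1 predT (fun j => w (q j)) isT.
have qj0 : q j0 != 0.
  rewrite -(absval_gt0 wA); apply: lt_le_trans (j0max j1 isT).
  by rewrite (absval_gt0 wA).
pose p j := q j / q j0.
have p1 j : w (p j) <= 1.
  by rewrite /p (absvalM wA) (absvalV wA) ler_pdivrMr ?(absval_gt0 wA) // mul1r; apply: j0max.
have Hp : \sum_j p j *: (y (tag j) * X j) = 0.
  under eq_bigr => j _ do rewrite /p mulrC -scalerA.
  by rewrite -scaler_sumr Hq scaler0.
pose i0 := tag j0.
pose p0 (l : 'I_(d i0)) := p (Tagged (fun i => 'I_(d i)) l : J).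
have p0_1 : exists l : 'I_(d i0), p0 l = 1.
  by exists (tagged j0); rewrite /p0 taggedK /p divff.
have [del0 /(_ p0 (fun l => p1 _) p0_1)] := Hdel i0.
(* Subtracting the relation leaves the multipliers [1 - y] at the place [i0] and [- y] elsewhere,
   all of size at most [e] at that place. *)
have -> : \sum_l p0 l *: x i0 l = \sum_j p j *: (((tag j == i0)%:R - y (tag j)) * X j).
  under [RHS]eq_bigr => j _ do rewrite mulrBl scalerBr.
  rewrite sumrB Hp subr0.
  rewrite -(big_pred1_eq +%R i0 (fun i => \sum_l p (Tagged (fun i => 'I_(d i)) l : J) *: x i l)).
  rewrite sig_big_dep /= [RHS]big_mkcond [LHS]big_mkcond; apply: eq_bigr => j _ /=.
  rewrite andbT taggedK /X; case: eqP => _; first by rewrite mul1r.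
  by rewrite mul0r scaler0.
apply/negP; rewrite -ltNge.
apply: (@le_lt_trans _ _ (\sum_j e * a i0 (X j))).
  apply: le_trans (absval_sum (aA i0) _ _ _) _; apply: ler_sum => j _.
  rewrite -mulr_algl !(absvalM (aA i0)) (aP i0).2 mulrA.
  apply: ler_wpM2r; rewrite ?(absval_ge0 (aA i0)) //.
  rewrite -[leRHS]mul1r; apply: ler_pM; rewrite ?(absval_ge0 (aA i0)) ?(absval_ge0 wA) //.
  have [y1 y2] := Hy (tag j); case: eqP => [E|/eqP E].
    by rewrite (absvalBC (aA i0)) -E ltW.
  by rewrite sub0r (absvalN (aA i0)) ltW // y2 // eq_sym.
rewrite -mulr_sumr -/(C i0).
have Cp : 0 < C i0 + 1 by rewrite ltr_wpDl.
have : e <= del i0 / (C i0 + 1) by apply: bigmin_le.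
rewrite ler_pdivlMr // mulrDr mulr1; apply: lt_le_trans.
by rewrite ltrDl.
Qed.
End LocalDegree.

(** * Embeddings and the places above a place of Q *)

Definition is_embedding (k M : fieldExtType rat) (s : k -> M) : Prop :=
  [/\ forall q x y, s (q *: x + y) = q *: s x + s y,
      forall x y, s (x * y) = s x * s y & s 1 = 1].

(** The minimal polynomial of a primitive element [th] has [k : Q] distinct complex roots, which
    generate [M]; each embedding evaluates at a root a polynomial representing the element at
    [th]. *)
Lemma exists_embeddings (k : fieldExtType rat) :
  exists (M : fieldExtType rat) (th : k) (s : 'I_(\dim {:k}) -> k -> M),
    (forall i, is_embedding (s i)) /\ injective (fun i => s i th).
Proof.
have char0 : [pchar k] =i pred0 := ftrans (pchar_lalg k) (pchar_num _).
have sepk : separable 1 {:k}.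
  by apply/separableP => u _; apply: pcharf0_separable.
pose th := separable_generator 1 {:k}.
have gen_th : <<1; th>>%VS = {:k}%VS.
  by rewrite -eq_adjoin_separable_generator ?sub1v.
have /polyOver1P[f0 Ef] := minPolyOver 1 th.
have f0N0 : f0 != 0.
  by rewrite -(map_poly_eq0 (in_alg k)) -Ef monic_neq0 // monic_minPoly.
have sz_f0 : size f0 = (\dim {:k}).+1.
  by rewrite -(size_map_poly (in_alg k)) -Ef size_minPoly -gen_th dim_Fadjoin dimv1 muln1.
have sep_f0 : separable_poly f0.
  by rewrite -(separable_map (in_alg k)) -Ef; apply: (pcharf0_separable 1%VS).
pose toC := map_poly (ratr : rat -> algC).
have [rs Ers] := closed_field_poly_normal (toC f0).
have lcN0 : lead_coef (toC f0) != 0 by rewrite lead_coef_eq0 map_poly_eq0.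
have urs : uniq rs.
  rewrite -separable_prod_XsubC; have := sep_f0.
  by rewrite -(separable_map (ratr : {rmorphism rat -> algC})) -/(toC f0) Ers (eqp_separable (eqp_scale _ lcN0)).
have srs : size rs = \dim {:k}.
  apply: succn_inj; rewrite -sz_f0 -(size_map_poly (ratr : {rmorphism rat -> algC})).
  by rewrite -/(toC f0) Ers size_scale // size_prod_XsubC.
have [M [QsC [s1 Es1 _]]] := num_field_exists rs.
have us1 : uniq s1 by rewrite -(map_inj_uniq (fmorph_inj QsC)) Es1.
have ss1 : size s1 = \dim {:k} by rewrite -srs -Es1 size_map.
have toM p z : QsC (map_poly (in_alg M) p).[z] = (toC p).[QsC z].
  rewrite -horner_map -map_poly_comp; congr (_.[_]).
  by apply: eq_map_poly => q /=; rewrite -(fmorph_eq_rat (QsC \o in_alg M)).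
have root_s1 z : z \in s1 -> (map_poly (in_alg M) f0).[z] = 0.
  move=> zs; apply: (fmorph_inj QsC); rewrite toM rmorph0 Ers hornerZ.
  apply/eqP; rewrite mulf_eq0 (negbTE lcN0) /= -rootE root_prod_XsubC.
  by rewrite -Es1 map_f.
(* The value at a root is independent of the representing polynomial, because [f0] divides the
   difference of two of them. *)
have eval_eq p q z : z \in s1 ->
    (map_poly (in_alg k) p).[th] = (map_poly (in_alg k) q).[th] ->
    (map_poly (in_alg M) p).[z] = (map_poly (in_alg M) q).[z].
  move=> zs /eqP; rewrite -subr_eq0 -hornerN -hornerD -raddfB -rootE => rt.
  have : f0 %| p - q.
    rewrite -(dvdp_map (in_alg k)) -Ef minPoly_dvdp //.
    by apply/polyOver1P; exists (p - q).
  case/dvdpP => h Eh; apply/eqP; rewrite -subr_eq0 -hornerN -hornerD -raddfB Eh.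
  by rewrite /= rmorphM hornerM root_s1 // mulr0.
have /choice [g Hg] x : exists p, x = (map_poly (in_alg k) p).[th].
  by apply/Fadjoin1_polyP; rewrite gen_th memvf.
pose r (i : 'I_(\dim {:k})) := s1`_i.
have rs1 i : r i \in s1 by rewrite mem_nth // ss1.
exists M, th, (fun i x => (map_poly (in_alg M) (g x)).[r i]); split.
  move=> i; split.
  - move=> q x y; have -> : (map_poly (in_alg M) (g (q *: x + y))).[r i] =
        (map_poly (in_alg M) (q *: g x + g y)).[r i].
      apply: eval_eq => //; rewrite -Hg rmorphD /= hornerD -Hg linearZ /= hornerZ -Hg.
      by rewrite mulr_algl.
    by rewrite rmorphD /= hornerD linearZ /= hornerZ mulr_algl.
  - move=> x y; rewrite -hornerM -rmorphM; apply: eval_eq => //.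
    by rewrite rmorphM hornerM -!Hg.
  - rewrite -[RHS](hornerC 1 (r i)) polyC1 -(rmorph1 (map_poly (in_alg M))).
    by apply: eval_eq => //; rewrite -Hg rmorph1 hornerC.
have gth i : (map_poly (in_alg M) (g th)).[r i] = r i.
  rewrite -[RHS]hornerX -(map_polyX (in_alg M)); apply: eval_eq => //.
  by rewrite -Hg map_polyX hornerX.
move=> i j; rewrite !gth => /eqP; rewrite nth_uniq ?ss1 // => /eqP; exact: val_inj.
Qed.

Section Embeddings.
Variables (k M : fieldExtType rat).
Local Notation d := (\dim {:k}).
Variables (s : 'I_d -> k -> M) (th : k).
Hypotheses (sE : forall i, is_embedding (s i)) (s_inj : injective (fun i => s i th)).

Lemma embM i x y : s i (x * y) = s i x * s i y. Proof. by case: (sE i). Qed.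
Lemma emb1 i : s i 1 = 1. Proof. by case: (sE i). Qed.
Lemma emb0 i : s i 0 = 0.
Proof.
case: (sE i) => sL _ _; have := sL 1 0 0.
by rewrite !scale1r addr0 -{1}[s i 0]addr0 => /addrI.
Qed.
Lemma embD i x y : s i (x + y) = s i x + s i y.
Proof. by case: (sE i) => sL _ _; rewrite -[x in LHS]scale1r sL scale1r. Qed.
Lemma embZ i q x : s i (q *: x) = q *: s i x.
Proof. by case: (sE i) => sL _ _; rewrite -[q *: x]addr0 sL emb0 addr0. Qed.
Lemma emb_sum i (I : Type) (r : seq I) (F : I -> k) :
  s i (\sum_(j <- r) F j) = \sum_(j <- r) s i (F j).
Proof. exact: (big_morph (s i) (embD i) (emb0 i)). Qed.
Lemma embX i x n : s i (x ^+ n) = s i x ^+ n.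
Proof. by elim: n => [|n IH]; rewrite ?expr0 ?emb1 // !exprS embM IH. Qed.
Lemma emb_eq0 i x : (s i x == 0) = (x == 0).
Proof.
apply/eqP/eqP => [|->]; last exact: emb0.
move=> sx0; apply/eqP/negP => /negP xN0.
by have /eqP := emb1 i; rewrite -(mulfV xN0) embM sx0 mul0r eq_sym oner_eq0.
Qed.

Lemma embedding_absval (R : realType) (w : rat -> R) (b : M -> R) i :
  place_over w b -> place_over w (fun x => b (s i x)).
Proof.
move=> [bA bw]; split.
  split=> [x|x|x y|x y]; rewrite ?embM ?embD ?(absvalM bA) ?(absvalD bA) ?(absval_ge0 bA) //.
  by split=> [/eqP|->]; rewrite ?emb0 ?(absval0 bA) // (absval_eq0 bA) emb_eq0 => /eqP.
by move=> q; rewrite embZ emb1.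
Qed.

Lemma Vandermonde_unit n (h : 'I_n -> 'I_d) : injective h ->
  Vandermonde n (\row_j s (h j) th) \in unitmx.
Proof.
move=> h_inj; rewrite unitmxE det_Vandermonde unitfE.
apply/prodf_neq0 => i _; apply/prodf_neq0 => j ij; rewrite !mxE subr_eq0.
apply/eqP => /s_inj /h_inj E; by rewrite E ltnn in ij.
Qed.

(** The matrix of conjugates of a basis diagonalises multiplication by [c]. It is invertible because
    it is a factor of the Vandermonde matrix of the conjugates of [th]. *)
Lemma prod_embeddings (c : k) : (\det (mulmat c))%:A = \prod_i s i c.
Proof.
pose e := vbasis {:k}.
pose V : 'M[M]_d := \matrix_(i, j) s i e`_j.
pose E : 'M[M]_d := \matrix_(i, j) (coord e j (th ^+ i))%:A.
have EV : Vandermonde d (\row_j s j th) = E *m V^T.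
  apply/matrixP => i j; rewrite !mxE -embX.
  rewrite {1}(coord_vbasis (memvf (th ^+ i))) emb_sum; apply: eq_bigr => l _.
  by rewrite embZ !mxE mulr_algl.
have DV : diag_mx (\row_i s i c) *m V = V *m (map_mx (in_alg M) (mulmat c))^T.
  apply/matrixP => i j; rewrite mul_diag_mx !mxE -embM mulrC mulmatE emb_sum.
  apply: eq_bigr => l _; rewrite embZ -mulr_algl mulrC [V i l]mxE; congr (_ * _).
  by rewrite [RHS]mxE [RHS]mxE.
have := Vandermonde_unit (@inj_id _).
rewrite EV unitmx_mul => /andP[_]; rewrite unitmx_tr unitmxE unitfE => detV.
have := congr1 determinant DV.
rewrite !det_mulmx det_tr det_diag det_map_mx mulrC => /(mulfI detV) /= <-.
by apply: eq_bigr => i _; rewrite mxE.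
Qed.

Section LowerBound.
Variables (R : realType) (w : rat -> R) (b : M -> R).
Hypothesis bw : place_over w b.

(** Powers of [th], one for each embedding inducing [a], are independent: a small combination has
    small images under all these embeddings, and inverting a Vandermonde system shows that its
    coefficients are small. *)
Lemma local_degree_ge (a : k -> R) :
  (#|[pred i | (fun x => b (s i x)) == a]| <= local_degree a)%N.
Proof.
have [bA bq] := bw.
set E := [pred i | _]; pose n := #|E|.
have nd : (n < d.+1)%N by rewrite ltnS -[X in (_ <= X)%N]card_ord max_card.
apply: (@leq_trans (Ordinal nd)) => //; apply: leq_bigmax_cond; apply/asboolP.
exists (fun j : 'I_n => th ^+ j) => -[c [_ [l Hl] Hnull]]; apply: Hl.
pose r := \row_(j < n) s (enum_val j) th; pose W := Vandermonde n r.
have Wu : W \in unitmx by apply: Vandermonde_unit; apply: enum_val_inj.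
(* Column [l] of the inverse Vandermonde matrix bounds the [l]-th coefficient by [K] times the size
   of the combination. *)
pose K := \sum_i b (invmx W i l).
have K0 : 0 <= K by apply: sumr_ge0 => i _; apply: (absval_ge0 bA).
move=> e e0; have eK : 0 < e / (K + 1) by rewrite divr_gt0 // ltr_wpDl.
have [N HN] := Hnull _ eK; exists N => t /HN; set u := \sum_i _ => ltu.
have [i0 Ei0] : exists i0, i0 \in E.
  by apply/card_gt0P; apply: leq_ltn_trans (leq0n l) (ltn_ord l).
have aE i : i \in E -> forall x, b (s i x) = a x by move=> /eqP <-.
pose ct : 'rV[M]_n := \row_j (c j t)%:A.
have uE i : (ct *m W) 0 i = s (enum_val i) u.
  rewrite mxE emb_sum; apply: eq_bigr => j _.
  by rewrite !mxE embZ embX mulr_algl.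
have {}Ei0 : a = fun x => b (s i0 x) by apply/esym/eqP.
have -> : a (c l t)%:A = b (ct 0 l) by rewrite Ei0 embZ emb1 mxE.
have {1}-> : ct = (ct *m W) *m invmx W by rewrite mulmxK.
rewrite mxE; apply: le_lt_trans (absval_sum bA _ _ _) _.
apply: (@le_lt_trans _ _ (a u * K)).
  rewrite mulr_sumr; apply: ler_sum => i _.
  by rewrite (absvalM bA) uE aE ?enum_valP.
apply: (@le_lt_trans _ _ (a u * (K + 1))).
  by rewrite Ei0 ler_wpM2l ?(absval_ge0 bA) // lerDl.
by rewrite -ltr_pdivlMr // ltr_wpDl.
Qed.
End LowerBound.
End Embeddings.

(** * The local norm formula above a place of Q *)

Section PlacesOver.
Variables (R : realType) (k : fieldExtType rat) (w : rat -> R).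
Hypotheses (wA : absval w) (w_nontriv : exists q : rat, q != 0 /\ w q < 1).
Hypothesis w_tb : totally_bounded w.

(** The element 1 alone is locally independent. *)
Lemma local_degree_gt0 (a : k -> R) : place_over w a -> (0 < local_degree a)%N.
Proof.
move=> [aA aw]; have D0 : (1 < (\dim {:k}).+1)%N by rewrite ltnS (adim_gt0 (aspacef k)).
apply: (@leq_trans (Ordinal D0)) => //; apply: leq_bigmax_cond; apply/asboolP.
exists (fun=> 1) => -[c [_ [i Hi] Hn]]; apply: Hi => e /Hn[N HN]; exists N => n /HN.
by rewrite big_ord1 (ord1 i).
Qed.

(** The list [r] has [k : Q] entries, and each place occurs in it at most as often as its local
    degree. Since the local degrees add up to at most [k : Q], all these bounds are equalities. *)
Lemma places_over_w : exists S : seq (k -> R),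
  [/\ uniq S, forall a, (a \in S) <-> place_over w a, S != [::] &
      forall c : k, \prod_(a <- S) a c ^+ local_degree a = w (\det (mulmat c))].
Proof.
have [M [th [s [sE s_inj]]]] := exists_embeddings k.
have [b [bA bw]] := exists_absval_over M wA.
have pb : place_over w b by [].
pose f i : k -> R := fun x => b (s i x).
pose r := [seq f i | i <- enum 'I_(\dim {:k})].
have rP a : a \in undup r -> place_over w a.
  rewrite mem_undup => /mapP[i _ ->]; exact: (embedding_absval sE _ pb).
have count_r a : count_mem a r = #|[pred i | f i == a]|.
  by rewrite count_map cardE enumT -size_filter.
have count_le a : (count_mem a r <= local_degree a)%N.
  by rewrite count_r; apply: (local_degree_ge sE s_inj pb).
have sum_count : (\sum_(a <- undup r) count_mem a r = \dim {:k})%N.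
  have <- : size r = \dim {:k} by rewrite size_map size_enum_ord.
  rewrite -sum1_size -[RHS]big_undup_iterop_count; apply: eq_bigr => a _.
  by rewrite Monoid.iteropE iter_addn addn0 mul1n.
have sum_le := @sum_local_degree_le R k w wA w_nontriv w_tb.
have deg_eq a : a \in undup r -> local_degree a = count_mem a r.
  move=> ar; apply/eqP; rewrite eqn_leq count_le andbT.
  rewrite -(leq_add2r (\sum_(a' <- rem a (undup r)) count_mem a' r)).
  have h (F : (k -> R) -> nat) : (F a + \sum_(a' <- rem a (undup r)) F a' =
      \sum_(a' <- undup r) F a')%N.
    by rewrite (perm_big _ (perm_to_rem ar)) big_cons.
  rewrite (h (fun a' => count_mem a' r)) sum_count.
  have := sum_le _ (undup_uniq r) rP.
  apply: leq_trans; rewrite -h leq_add2l.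
  by apply: leq_sum => a' _.
exists (undup r); split.
- exact: undup_uniq.
(* A further place, with its positive local degree, would push the sum above [k : Q]. *)
- move=> a; split=> [/rP//|aw]; apply/negP => /negP ar.
  have := sum_le (a :: undup r); rewrite /= ar undup_uniq big_cons => /(_ isT).
  have -> : (\sum_(a' <- undup r) local_degree a' = \dim {:k})%N.
    by rewrite -sum_count; apply: eq_big_seq => a' /deg_eq.
  rewrite leqNgt -{1}[\dim _]add0n ltn_add2r local_degree_gt0 //= => H.
  by suff: false by []; apply: H => a'; rewrite in_cons => /orP[/eqP ->|/rP].
- apply/eqP => E; have := sum_count; rewrite E big_nil => /esym/eqP.
  by rewrite gtn_eqF // (adim_gt0 (aspacef k)).
- move=> c; rewrite -bw (prod_embeddings sE s_inj) (absval_prod bA).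
  have -> : \prod_i b (s i c) = \prod_(a <- r) a c.
    by rewrite big_map big_enum.
  (* Grouping the embeddings by the place they induce turns multiplicities into exponents. *)
  rewrite -[RHS]big_undup_iterop_count; apply: eq_big_seq => a /deg_eq ->.
  by [].
Qed.
End PlacesOver.

(** * The places of Q *)

Section ArchimedeanPlace.
Variable R : realType.

Definition arch_abs (q : rat) : R := `|ratr q|.

Lemma arch_abs_absval : absval arch_abs.
Proof.
split=> [x|x|x y|x y]; rewrite /arch_abs.
- exact: normr_ge0.
- by split=> [/eqP|->]; [rewrite normr_eq0 fmorph_eq0 => /eqP | rewrite rmorph0 normr0].
- by rewrite rmorphM normrM.
- by rewrite rmorphD ler_normD.
Qed.

Lemma arch_abs_nontriv : exists q : rat, q != 0 /\ arch_abs q < 1.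
Proof.
exists 2^-1; split; first by [].
by rewrite /arch_abs fmorphV /= ratr_nat ger0_norm ?invr_ge0 ?ler0n // invf_lt1 ?ltr0n // ltr1n.
Qed.

(** Truncating (q + 1) n with n > 1/e cuts the interval [-1, 1] into cells of length 1/n. *)
Lemma arch_abs_tb : totally_bounded arch_abs.
Proof.
move=> e e0; have eV0 : 0 <= e^-1 by rewrite invr_ge0 ltW.
pose n := (Num.bound e^-1).+1.
have ne : e^-1 < n%:R by apply: lt_le_trans (archi_boundP eV0) _; rewrite ler_nat.
have n0 : 0 < n%:R :> R by rewrite ltr0n.
pose t (q : rat) := Num.truncn ((ratr q + 1 : R) * n%:R).
have tE q : arch_abs q <= 1 ->
    (t q)%:R <= (ratr q + 1 : R) * n%:R < (t q).+1%:R /\ (t q < (2 * n).+1)%N.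
  rewrite /arch_abs ler_norml => /andP[q1 q2].
  have h : 0 <= (ratr q + 1 : R) * n%:R by rewrite mulr_ge0 ?ler0n //; lra.
  have /andP[h1 h2] := truncn_itv h.
  rewrite h1 h2; split=> //; rewrite ltnS -(ler_nat R); apply: le_trans h1 _.
  by rewrite natrM ler_wpM2r ?ler0n //; lra.
exists 'I_(2 * n).+1, (fun q => inord (t q)) => p q /tE[/andP[p1 p2] p3] /tE[/andP[q1 q2] q3].
move/(congr1 (@nat_of_ord _)); rewrite !inordK // => E; rewrite E in p1 p2.
rewrite /arch_abs rmorphB /= -(ltr_pM2r n0) -{1}[n%:R]ger0_norm ?ltW // -normrM.
apply: (@lt_trans _ _ 1); last by rewrite mulrC -ltr_pdivrMr // mul1r.
rewrite mulrBl ltr_norml; move: p1 p2 q1 q2.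
rewrite !mulrDl mul1r -addn1 natrD => *; lra.
Qed.
End ArchimedeanPlace.

(** * The p-adic places of Q *)

Section PadicPlace.
Variables (R : realType) (p : nat).
Hypothesis p_pr : prime p.
Let p_gt0 : 0 < p%:R :> R. Proof. by rewrite ltr0n prime_gt0. Qed.
Let p_gt1 : 1 < p%:R :> R. Proof. by rewrite ltr1n prime_gt1. Qed.
Let pN0 : p%:R != 0 :> R. Proof. by rewrite gt_eqF. Qed.

Lemma padic_abs0 : padic_abs R p 0 = 0. Proof. by rewrite /padic_abs eqxx. Qed.

Lemma padic_abs_gt0 q : q != 0 -> 0 < padic_abs R p q.
Proof. by move=> /negbTE qN0; rewrite /padic_abs qN0 exprz_gt0. Qed.

Lemma padic_abs_ge0 q : 0 <= padic_abs R p q.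
Proof. by have [->|/padic_abs_gt0/ltW//] := eqVneq q 0; rewrite padic_abs0. Qed.

(** The fraction need not be reduced, which allows common denominators; cross-multiplication
    compares it with the reduced one. *)
Lemma padic_abs_frac (n m : int) : n != 0 -> m != 0 ->
  padic_abs R p (n%:~R / m%:~R) = p%:R ^+ logn p `|m|%N / p%:R ^+ logn p `|n|%N.
Proof.
move=> nN0 mN0; set q : rat := _ / _.
have mN0' : m%:~R != 0 :> rat by rewrite intr_eq0.
have qN0 : q != 0 by rewrite mulf_neq0 ?invr_eq0 ?intr_eq0.
have E : numq q * m = n * denq q.
  apply: (@intr_inj rat); rewrite !rmorphM /= numqE.
  by rewrite mulrAC divfK.
have := congr1 absz E; rewrite !abszM => /(congr1 (logn p)).
rewrite !lognM ?absz_gt0 ?denq_neq0 ?numq_eq0 // => Elog.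
rewrite /padic_abs (negbTE qN0) opprB expfzDr // -exprnP -exprnN.
apply/eqP; rewrite eqr_div ?expf_neq0 // -!exprD; apply/eqP; congr (_ ^+ _).
by rewrite addnC -Elog addnC.
Qed.

Lemma padic_absM x y : padic_abs R p (x * y) = padic_abs R p x * padic_abs R p y.
Proof.
have [->|xN0] := eqVneq x 0; first by rewrite mul0r padic_abs0 mul0r.
have [->|yN0] := eqVneq y 0; first by rewrite mulr0 padic_abs0 mulr0.
rewrite -[(x * y) in LHS](congr2 *%R (divq_num_den x) (divq_num_den y)) mulf_div -!rmorphM /=.
rewrite padic_abs_frac ?mulf_neq0 ?denq_neq0 ?numq_eq0 //.
have E z : z != 0 -> padic_abs R p z =
    p%:R ^+ logn p `|denq z|%N / p%:R ^+ logn p `|numq z|%N.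
  by move=> zN0; rewrite -[z in LHS]divq_num_den padic_abs_frac ?denq_neq0 ?numq_eq0.
by rewrite !E // mulf_div !abszM !lognM ?absz_gt0 ?denq_neq0 ?numq_eq0 // !exprD.
Qed.

(** Over a common denominator this says that a power of [p] dividing two integers divides their
    sum. *)
Lemma padic_abs_max x y : padic_abs R p (x + y) <= Num.max (padic_abs R p x) (padic_abs R p y).
Proof.
have [->|xyN0] := eqVneq (x + y) 0; first by rewrite padic_abs0 le_max padic_abs_ge0.
have [->|xN0] := eqVneq x 0; first by rewrite add0r le_max lexx orbT.
have [->|yN0] := eqVneq y 0; first by rewrite addr0 le_max lexx.
pose D := denq x * denq y.
have DN0 : D != 0 by rewrite mulf_neq0 ?denq_neq0.
have DrN0 : D%:~R != 0 :> rat by rewrite intr_eq0.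
pose nx := numq x * denq y; pose ny := numq y * denq x.
have Ex : x = nx%:~R / D%:~R.
  rewrite -{1}[x]divq_num_den /nx /D !rmorphM /= -mulf_div divff ?mulr1 //.
  by rewrite intr_eq0 denq_neq0.
have Ey : y = ny%:~R / D%:~R.
  rewrite -{1}[y]divq_num_den /ny /D !rmorphM /= [(denq x)%:~R * _]mulrC -mulf_div divff ?mulr1 //.
  by rewrite intr_eq0 denq_neq0.
have Exy : x + y = (nx + ny)%:~R / D%:~R by rewrite rmorphD /= mulrDl -Ex -Ey.
have nz (z : rat) n : z = n%:~R / D%:~R -> z != 0 -> n != 0.
  by move=> ->; apply: contraNneq => ->; rewrite mul0r.
have nxN0 := nz _ _ Ex xN0; have nyN0 := nz _ _ Ey yN0; have nN0 := nz _ _ Exy xyN0.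
rewrite {1}Exy {1}Ex {1}Ey !padic_abs_frac //.
have le_frac (i : nat) n : (i <= logn p `|n|)%N ->
    p%:R ^+ logn p `|D| / p%:R ^+ logn p `|n| <= p%:R ^+ logn p `|D| / p%:R ^+ i :> R.
  move=> h; rewrite ler_pM2l ?exprn_gt0 // lef_pV2 ?posrE ?exprn_gt0 //.
  by rewrite ler_eXn2l.
have dv (i : nat) n : n != 0 -> (i <= logn p `|n|)%N = (p%:Z ^+ i %| n)%Z.
  move=> h; rewrite -pfactor_dvdn ?absz_gt0 // dvdzE.
  by rewrite abszX.
rewrite le_max; apply/orP.
have [le|/ltnW le] := leqP (logn p `|nx|) (logn p `|ny|); [left|right]; apply: le_frac.
  by rewrite dv // rpredD -?dv.
by rewrite dv // rpredD -?dv.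
Qed.

Lemma padic_absval : absval (padic_abs R p).
Proof.
split.
- exact: padic_abs_ge0.
- move=> x; split=> [/eqP|->]; last exact: padic_abs0.
  by apply: contraTeq => /padic_abs_gt0; rewrite lt0r => /andP[].
- exact: padic_absM.
- move=> x y; apply: le_trans (padic_abs_max x y) _.
  by rewrite ge_max lerDl lerDr !padic_abs_ge0.
Qed.

Lemma padic_abs_p : padic_abs R p p%:R = p%:R^-1.
Proof.
have -> : p%:R = p%:Z%:~R / 1%:~R :> rat by rewrite divr1.
rewrite padic_abs_frac // ?eqz_nat -?lt0n ?prime_gt0 //.
by rewrite logn1 expr0 mul1r /= logn_prime // eqxx expr1.
Qed.

Lemma padic_abs_nontriv : exists q : rat, q != 0 /\ padic_abs R p q < 1.
Proof.
exists p%:R; rewrite pnatr_eq0 -lt0n prime_gt0 // padic_abs_p; split=> //.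
by rewrite invf_lt1.
Qed.

Lemma padic_abs_int_den (q : rat) : ~~ (p %| `|denq q|)%N -> padic_abs R p q <= 1.
Proof.
have [->|qN0] := eqVneq q 0; first by rewrite padic_abs0 ler01.
move=> ndvd; rewrite -[q]divq_num_den padic_abs_frac ?denq_neq0 ?numq_eq0 //.
rewrite (_ : logn p `|denq q| = 0%N); last first.
  by apply/eqP; rewrite -leqn0 leqNgt; apply: contra ndvd; rewrite logn_gt0 mem_primes => /and3P[].
by rewrite expr0 mul1r invf_le1 ?exprn_gt0 // exprn_ege1 // ltW.
Qed.

Lemma padic_abs_le1_den (q : rat) : padic_abs R p q <= 1 -> coprime p `|denq q|.
Proof.
move=> q1; rewrite prime_coprime //; apply: contraTN q1 => pd; rewrite -ltNge.
have qN0 : q != 0.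
  by apply: contraTneq pd => ->; rewrite /= Euclid_dvd1.
have pn : logn p `|numq q| = 0%N.
  apply/eqP; rewrite -leqn0 leqNgt logn_gt0 mem_primes p_pr absz_gt0 numq_eq0 qN0 /=.
  apply/negP => pn; have := coprime_num_den q.
  move/(coprime_dvdl pn); move/(coprime_dvdr pd).
  by rewrite /coprime gcdnn; case: (p) p_pr => [|[]].
rewrite -[q]divq_num_den padic_abs_frac ?denq_neq0 ?numq_eq0 //.
rewrite pn expr0 divr1 exprn_egt1 // -lt0n logn_gt0 mem_primes p_pr pd andbT /=.
by rewrite absz_gt0 denq_neq0.
Qed.

(** The pieces are residue classes: denominators in the unit ball are prime to [p], hence invertible
    modulo powers of [p]. *)
Lemma padic_abs_tb : totally_bounded (padic_abs R p).
Proof.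
move=> e e0.
have [n Hn] : exists n, (p%:R^-1 : R) ^+ n < e.
  by apply: expr_lt_small; rewrite ?invr_ge0 ?ltW // invf_lt1.
(* The exponent [n.+1] ensures [m > 1], so that ['Z_m] really is the ring of integers modulo [m]. *)
pose m := (p ^ n.+1)%N.
have m1 : (1 < m)%N by rewrite -(expn0 p) ltn_exp2l // prime_gt1.
exists 'Z_m, (fun q => (numq q)%:~R / (denq q)%:~R) => x y x1 y1 Exy.
have unit_den q : padic_abs R p q <= 1 -> (denq q)%:~R \is a @GRing.unit 'Z_m.
  move/padic_abs_le1_den => cop; rewrite -[denq q]gez0_abs ?denq_ge0 //.
  by rewrite unitZpE // coprime_sym coprimeXr // coprime_sym.
have int0 (z : int) : z%:~R = 0 :> 'Z_m -> (m %| `|z|)%N.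
  move=> z0; have : `|z|%:R = 0 :> 'Z_m.
    by case: z z0 => i //; rewrite NegzE rmorphN /= => /eqP; rewrite oppr_eq0 => /eqP.
  by move/(congr1 (@nat_of_ord _)); rewrite val_Zp_nat // => /eqP.
have dvd : (m %| `|(numq x * denq y - numq y * denq x)%R|)%N.
  apply: int0; rewrite rmorphB !rmorphM /=; apply/eqP; rewrite subr_eq0; apply/eqP.
  have := congr1 (fun z => z * (denq x)%:~R * (denq y)%:~R) Exy.
  by rewrite divrK ?unit_den // mulrAC divrK ?unit_den // => ->; rewrite mulrAC divrK ?unit_den.
have [->|xyN0] := eqVneq (x - y) 0; first by rewrite padic_abs0.
have Dx : (denq x)%:~R != 0 :> rat by rewrite intr_eq0 denq_neq0.
have Dy : (denq y)%:~R != 0 :> rat by rewrite intr_eq0 denq_neq0.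
have E : x - y = (numq x * denq y - numq y * denq x)%:~R / (denq x * denq y)%:~R.
  by rewrite -{1}[x]divq_num_den -{1}[y]divq_num_den rmorphB !rmorphM /=; field; rewrite Dx Dy.
have nN0 : numq x * denq y - numq y * denq x != 0.
  by apply: contraNneq xyN0 => h; rewrite E h mul0r.
rewrite E padic_abs_frac ?mulf_neq0 ?denq_neq0 //.
have -> : logn p `|(denq x * denq y)%R| = 0%N.
  rewrite abszM lognM ?absz_gt0 ?denq_neq0 //.
  have h q : padic_abs R p q <= 1 -> logn p `|denq q| = 0%N.
    by move/padic_abs_le1_den; rewrite prime_coprime // => /negbTE h; rewrite lognE h !andbF.
  by rewrite !h.
rewrite expr0 mul1r; apply: le_lt_trans Hn; rewrite exprVn lef_pV2 ?posrE ?exprn_gt0 //.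
rewrite ler_eXn2l //; apply: ltnW; rewrite -pfactor_dvdn ?absz_gt0 //.
Qed.
End PadicPlace.

(** * The product formula *)

(** All primes dividing the numerator or the denominator lie below [B0], so the finite product is
    already |den| / |num|. *)
Lemma product_formula_rat (R : realType) (q : rat) : q != 0 ->
  exists B0, forall B, (B0 <= B)%N ->
    (\prod_(p < B | prime p) padic_abs R p q) * arch_abs R q = 1.
Proof.
move=> qN0; exists (maxn `|numq q| `|denq q|).+1%N => B; rewrite gtn_max => /andP[nB dB].
have part n : (0 < n)%N -> (n < B)%N -> \prod_(p < B | prime p) p%:R ^+ logn p n = n%:R :> R.
  move=> n0 nB'; case: B nB' {nB dB} => // B nB.
  rewrite -{2}(partnT n0) (widen_partn _ (nB : (n <= B)%N)) natr_prod big_mkord.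
  rewrite big_mkcond [RHS]big_mkcond; apply: eq_bigr => p _ /=.
  rewrite natrX; case: (boolP (prime p)) => // np.
  by rewrite lognE (negbTE np) expr0.
have nN0 : (0 < `|numq q|)%N by rewrite absz_gt0 numq_eq0.
have dN0 : (0 < `|denq q|)%N by rewrite absz_gt0 denq_neq0.
have absE (z : int) : `|z|%N%:R = `|z%:~R| :> R by rewrite natr_absz intr_norm.
rewrite (eq_bigr (fun p : 'I_B => p%:R ^+ logn p `|denq q| / p%:R ^+ logn p `|numq q|)); last first.
  by move=> p pp; rewrite -[q in LHS]divq_num_den padic_abs_frac ?denq_neq0 ?numq_eq0.
rewrite prodf_div !part // !absE /arch_abs -[q in ratr q]divq_num_den fmorph_div /=.
rewrite !ratr_int normrM normfV mulf_div [X in _ / X]mulrC divff //.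
by rewrite mulf_neq0 // normr_eq0 intr_eq0 ?denq_neq0 ?numq_eq0.
Qed.

(** * Units at almost all primes, and lists of the nonarchimedean places *)

Section HeightProducts.
Variables (R : realType) (k : fieldExtType rat).

(** Beyond all denominators of [mulmat c], the matrices of the powers of [c] are p-integral. The
    values a(c)^n are then bounded independently of [n], which excludes a(c) > 1. *)
Lemma place_eventually_le1 (c : k) :
  exists B0, forall p, prime p -> (B0 <= p)%N ->
    forall a : k -> R, place_over (padic_abs R p) a -> a c <= 1.
Proof.
pose d := \dim {:k}; pose B0 := (\max_(i < d) \max_(j < d) `|denq (mulmat c i j)|)%N.
exists B0.+1 => p pp pB a [aA aw].
have wA := padic_absval R pp.
have ent (n : nat) (i j : 'I_d) : padic_abs R p (mulmat (c ^+ n) i j) <= 1.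
  elim: n i j => [|n IH] i j.
    by rewrite expr0 mulmat1 mxE; case: eqP => _; rewrite ?(absval1 wA) ?(absval0 wA) ?ler01.
  rewrite exprSr mulmatM mxE; elim/big_ind: _ => [|x y x1 y1|l _].
  - by rewrite (absval0 wA) ler01.
  - by apply: le_trans (padic_abs_max R pp x y) _; rewrite ge_max x1.
  rewrite (absvalM wA); apply: mulr_ile1; rewrite ?(absval_ge0 wA) ?IH //.
  apply: padic_abs_int_den => //; apply/negP => /dvdn_leq.
  rewrite absz_gt0 denq_neq0 => /(_ isT) ple; have := leq_trans pB ple.
  rewrite ltnNge => /negP; apply.
  apply: leq_trans (leq_bigmax (F := fun i : 'I_d => \max_(j < d) `|denq (mulmat c i j)|)%N l).
  exact: (leq_bigmax (F := fun j : 'I_d => `|denq (mulmat c l j)|)%N j).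
rewrite leNgt; apply/negP => ac1.
pose e := vbasis {:k}; pose u (i : 'I_d) : rat := coord e i (1 : k).
pose K := \sum_(i < d) \sum_(j < d) padic_abs R p (u i) * a e`_j.
have bound n : a c ^+ n <= K.
  rewrite -(absvalX aA) -[c ^+ n]mul1r (coord_vbasis (memvf (1 : k))) mulr_suml.
  apply: le_trans (absval_sum aA _ _ _) _; apply: ler_sum => i _.
  rewrite -scalerAl mulmatE scaler_sumr; apply: le_trans (absval_sum aA _ _ _) _.
  apply: ler_sum => j _; rewrite scalerA -mulr_algl (absvalM aA) aw (absvalM wA).
  rewrite ler_wpM2r ?(absval_ge0 aA) // ler_piMr ?(absval_ge0 wA) //.
have K0 : 0 < K by apply: lt_le_trans (bound 0%N); rewrite expr0 ltr01.
have ap : 0 < a c by apply: lt_trans ac1.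
have [n] : exists n, (a c)^-1 ^+ n < K^-1.
  by apply: expr_lt_small; rewrite ?invr_ge0 ?(absval_ge0 aA) ?invf_lt1 ?invr_gt0.
by rewrite exprVn ltf_pV2 ?posrE ?exprn_gt0 // ltNge bound.
Qed.

Lemma place_eventually_eq1 (c : k) : c != 0 ->
  exists B0, forall p, prime p -> (B0 <= p)%N ->
    forall a : k -> R, place_over (padic_abs R p) a -> a c = 1.
Proof.
move=> cN0; have [B1 H1] := place_eventually_le1 c.
have [B2 H2] := place_eventually_le1 c^-1.
exists (maxn B1 B2) => p pp; rewrite geq_max => /andP[p1 p2] a ap.
apply/eqP; rewrite eq_le (H1 p pp p1 a ap) /=; have := H2 p pp p2 a ap.
by rewrite (absvalV ap.1) invf_le1 // (absval_gt0 ap.1).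
Qed.

(** The value at [p] is 1/p above [p] and 1 above any other prime. *)
Lemma padic_place_inj p q (a : k -> R) : prime p -> prime q ->
  place_over (padic_abs R p) a -> place_over (padic_abs R q) a -> p = q.
Proof.
move=> pp pq [_ ap] [_ aq]; apply/eqP/negP => /negP npq.
have := ap p%:R; rewrite aq padic_abs_p //.
have -> : p%:R = p%:Z%:~R / 1%:~R :> rat by rewrite divr1.
rewrite padic_abs_frac // ?eqz_nat -?lt0n ?prime_gt0 //= logn1 logn_prime // eq_sym.
rewrite (negbTE npq) expr0 divr1 => /esym/eqP; rewrite invr_eq1 pnatr_eq1.
by move/eqP => p1; rewrite p1 in pp.
Qed.

(** The list is empty at indices that are not prime, so [S] can be indexed by all natural
    numbers. *)
Definition nonarch_data (S : nat -> seq (k -> R)) : Prop :=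
  forall p, [/\ uniq (S p), forall a, a \in S p <-> prime p /\ place_over (padic_abs R p) a &
    prime p -> forall c : k, \prod_(a <- S p) a c ^+ local_degree a = padic_abs R p (\det (mulmat c))].

Lemma exists_nonarch_data : exists S, nonarch_data S.
Proof.
suff /choice[S HS] p : exists Sp : seq (k -> R),
    [/\ uniq Sp, forall a, a \in Sp <-> prime p /\ place_over (padic_abs R p) a &
    prime p -> forall c : k, \prod_(a <- Sp) a c ^+ local_degree a = padic_abs R p (\det (mulmat c))].
  by exists S.
have [pp|npp] := boolP (prime p); last first.
  by exists [::]; split=> // a; rewrite in_nil; split=> // -[].
have [Sp [h1 h2 _ h3]] :=
  places_over_w k (padic_absval R pp) (padic_abs_nontriv R pp) (@padic_abs_tb R p pp).
by exists Sp; split=> // a; rewrite h2; split=> [|[]].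
Qed.

Definition places_below (S : nat -> seq (k -> R)) B := flatten [seq S p | p <- iota 0 B].

Lemma places_below_uniq S B : nonarch_data S -> uniq (places_below S B).
Proof.
move=> HS; rewrite /places_below; elim: B => [//|B IH].
rewrite -addn1 iotaD map_cat flatten_cat cat_uniq IH /= cats0 add0n.
have [-> _ _] := HS B; rewrite andbT; apply/hasPn => a aB.
apply/negP => /flattenP [_ /mapP[p pB ->]] ap.
have [_ /(_ a) [/(_ aB) [pB' aB'] _] _] := HS B.
have [_ /(_ a) [/(_ ap) [pp' ap'] _] _] := HS p.
have E := padic_place_inj pB' pp' aB' ap'.
by rewrite -E mem_iota add0n ltnn andbF in pB.
Qed.

Lemma big_places_below S B (F : (k -> R) -> R) : nonarch_data S ->
  \prod_(a <- places_below S B) F a = \prod_(p < B | prime p) \prod_(a <- S p) F a.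
Proof.
move=> HS; rewrite big_flatten big_map /= -{1}[B]subn0 big_mkord [RHS]big_mkcond.
apply: eq_bigr => p _; case: ifP => // npp.
rewrite big1_seq // => a /= ap.
by have [_ /(_ a) [/(_ ap) []]] := HS p; rewrite npp.
Qed.

(** Replaces the product over an infinite set of places by one over a list outside of which the
    factors are 1. *)
Lemma fsbig_eq_seq (A : set (k -> R)) (r : seq (k -> R)) (F : (k -> R) -> R) :
  uniq r -> (forall a, a \in r -> A a) -> (forall a, A a -> a \notin r -> F a = 1) ->
  \big[*%R/1]_(a \in A) F a = \prod_(a <- r) F a.
Proof.
move=> ur rA rF; rewrite (@fsbigE _ _ _ _ A r F) //.
rewrite big_seq_cond [RHS]big_seq_cond; apply: eq_bigl => a.
case: (boolP (a \in r)) => //= ar.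
by apply: mem_set; apply: rA.
Qed.
End HeightProducts.

(** * Comparison of heights *)

Section LocalNorms.
Variables (R : realType) (k : fieldExtType rat) (a : k -> R).
Hypothesis aA : absval a.

Lemma vmax_ge0 (I : finType) (b : I -> k) : 0 <= vmax a b.
Proof. exact: bigmax_ge_id. Qed.

Lemma le_vmax (I : finType) (b : I -> k) i : a (b i) <= vmax a b.
Proof. exact: (le_bigmax _ (fun i => a (b i)) i). Qed.

Lemma vmax_gt0 (I : finType) (b : I -> k) i : b i != 0 -> 0 < vmax a b.
Proof. by rewrite -(absval_gt0 aA) => /lt_le_trans; apply; apply: le_vmax. Qed.

Lemma vmaxZ (I : finType) (b : I -> k) c : vmax a (fun i => c * b i) = a c * vmax a b.
Proof.
rewrite /vmax (big_morph (fun x => a c * x) (id1 := 0) (op1 := Num.max)) ?mulr0 //.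
  by apply: eq_bigr => i _; rewrite (absvalM aA).
by move=> x y; rewrite maxr_pMr // (absval_ge0 aA).
Qed.

Lemma le_vmax_embed (I J : finType) (b : I -> k) (b' : J -> k) (phi : I -> J) :
  (forall i, b i != 0 -> a (b' (phi i)) = a (b i)) -> vmax a b <= vmax a b'.
Proof.
move=> H; apply: bigmax_le => [|i _]; first exact: vmax_ge0.
have [->|bi] := eqVneq (b i) 0; first by rewrite (absval0 aA) vmax_ge0.
by rewrite -H // le_vmax.
Qed.

Definition vsqr (I : finType) (b : I -> k) : R := \sum_i a (b i) ^+ 2.

Lemma vsqr_ge0 (I : finType) (b : I -> k) : 0 <= vsqr b.
Proof. by apply: sumr_ge0 => i _; apply: sqr_ge0. Qed.

Lemma vl2_gt0 (I : finType) (b : I -> k) i : b i != 0 -> 0 < vl2 a b.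
Proof.
rewrite -(absval_gt0 aA) => ai; rewrite sqrtr_gt0 (bigD1 i) //=.
by rewrite ltr_pwDl ?exprn_gt0 // sumr_ge0 // => j _; apply: sqr_ge0.
Qed.

Lemma vl2Z (I : finType) (b : I -> k) c : vl2 a (fun i => c * b i) = a c * vl2 a b.
Proof.
rewrite /vl2; under eq_bigr => i _ do rewrite (absvalM aA) exprMn.
by rewrite -mulr_sumr sqrtrM ?sqr_ge0 // sqrtr_sqr ger0_norm // (absval_ge0 aA).
Qed.

Lemma vsqr_embed (I J : finType) (b : I -> k) (b' : J -> k) (phi : I -> J) :
  {in [pred i | b i != 0] &, injective phi} ->
  (forall i, b i != 0 -> a (b' (phi i)) = a (b i)) ->
  vsqr b' = vsqr b + \sum_(j | j \notin [set phi i | i in [pred i | b i != 0]]) a (b' j) ^+ 2.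
Proof.
move=> phi_inj H; rewrite /vsqr (bigID (fun j => j \in [set phi i | i in [pred i | b i != 0]])) /=.
congr (_ + _); rewrite big_imset //= [RHS](bigID (fun i => b i != 0)) /=.
rewrite [X in _ = _ + X]big1 ?addr0; last first.
  by move=> i /negPn/eqP ->; rewrite (absval0 aA) expr0n.
by apply: eq_bigr => i /H ->.
Qed.

Lemma le_vl2_embed (I J : finType) (b : I -> k) (b' : J -> k) (phi : I -> J) :
  {in [pred i | b i != 0] &, injective phi} ->
  (forall i, b i != 0 -> a (b' (phi i)) = a (b i)) -> vl2 a b <= vl2 a b'.
Proof.
move=> phi_inj H; apply: ler_wsqrtr; rewrite -/(vsqr b) -/(vsqr b') (vsqr_embed phi_inj H).
by rewrite lerDl sumr_ge0 // => j _; apply: sqr_ge0.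
Qed.

(** By [vsqr_embed] the squared norms differ by the sum of squares outside the image of [phi], which
    must then vanish term by term. *)
Lemma vl2_embed_eq (I J : finType) (b : I -> k) (b' : J -> k) (phi : I -> J) :
  {in [pred i | b i != 0] &, injective phi} ->
  (forall i, b i != 0 -> a (b' (phi i)) = a (b i)) -> vl2 a b = vl2 a b' ->
  forall j, b' j != 0 -> exists2 i, b i != 0 & j = phi i.
Proof.
move=> phi_inj H /eqP; rewrite eqr_sqrt ?vsqr_ge0 // -/(vsqr b) -/(vsqr b').
rewrite (vsqr_embed phi_inj H) -{1}[vsqr b]addr0 (inj_eq (addrI _)) eq_sym.
rewrite psumr_eq0 => [/allP Z|j _]; last exact: sqr_ge0.
move=> j bj; have := Z j (mem_index_enum j).
case: (boolP (j \in _)) => [/imsetP[i bi ->] _|_ /=]; first by exists i.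
by rewrite expf_eq0 (absval_eq0 aA) (negbTE bj).
Qed.
End LocalNorms.

(** * Heights as eventually constant finite products *)

Section Heights.
Variables (R : realType) (k : fieldExtType rat).
Local Notation height := (@height R k _).

Definition arch_data (T : seq (k -> R)) : Prop :=
  [/\ uniq T, forall a, a \in T <-> place_over (@arch_abs R) a, T != [::] &
    forall c : k, \prod_(a <- T) a c ^+ local_degree a = arch_abs R (\det (mulmat c))].

Lemma exists_arch_data : exists T, arch_data T.
Proof. exact: places_over_w (arch_abs_absval R) (arch_abs_nontriv R) (@arch_abs_tb R). Qed.

Variables (S : nat -> seq (k -> R)) (T : seq (k -> R)).
Hypotheses (HS : nonarch_data S) (HT : arch_data T).

(** The product defining the height, cut off at the primes below [B]. For nonzero [b] the cut is
    harmless from some [B] on, so two heights can be compared at a common [B]. *)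
Definition height_prod (I : finType) (b : I -> k) B : R :=
  (\prod_(a <- places_below S B) vmax a b ^+ local_degree a) *
  (\prod_(a <- T) vl2 a b ^+ local_degree a).

Lemma mem_places_below B a : a \in places_below S B -> exists2 p, prime p & place_over (padic_abs R p) a.
Proof.
case/flattenP => _ /mapP[p _ ->] ap; have [_ /(_ a) [/(_ ap) [pp pa] _] _] := HS p.
by exists p.
Qed.

Lemma absval_below B a : a \in places_below S B -> absval a.
Proof. by case/mem_places_below => p _ []. Qed.

Lemma absval_T a : a \in T -> absval a.
Proof. by case: HT => _ /(_ a) [h _] _ _ /h []. Qed.

Lemma vmax_eventually1 (I : finType) (b : I -> k) i0 : b i0 != 0 ->
  exists B0, forall p, prime p -> (B0 <= p)%N ->
    forall a : k -> R, place_over (padic_abs R p) a -> vmax a b = 1.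
Proof.
move=> bi0.
have /choice[B HB] i : exists B0, b i != 0 -> forall p, prime p -> (B0 <= p)%N ->
    forall a : k -> R, place_over (padic_abs R p) a -> a (b i) = 1.
  have [->|/(place_eventually_eq1 R)[B0 HB0]] := eqVneq (b i) 0; first by exists 0%N.
  by exists B0.
exists (\max_i B i)%N => p pp pB a pa; have aA := pa.1.
have ai i : b i != 0 -> a (b i) = 1.
  by move=> bi; apply: HB pa => //; apply: leq_trans pB; apply: leq_bigmax.
apply/eqP; rewrite eq_le -{2}(ai _ bi0) le_vmax andbT.
apply: bigmax_le => [|i _]; first exact: ler01.
by have [->|/ai ->//] := eqVneq (b i) 0; rewrite (absval0 aA) ler01.
Qed.

Lemma heightE (I : finType) (b : I -> k) i0 : b i0 != 0 ->
  exists B0, forall B, (B0 <= B)%N ->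
    height b = powR (height_prod b B) (\dim {:k})%:R^-1.
Proof.
move=> bi0; have [B0 HB0] := vmax_eventually1 bi0.
exists B0 => B leB; rewrite /Defs.height /height_prod; congr (powR (_ * _) _).
  apply: fsbig_eq_seq; first exact: places_below_uniq.
    by move=> a /mem_places_below[p pp [aA aw]]; split=> //; exists p.
  move=> a [aA [p [pp aw]]] aB; rewrite (HB0 p) ?expr1n //.
  apply: leq_trans leB _; rewrite leqNgt; apply: contra aB => pB.
  apply/flattenP; exists (S p); first by apply: map_f; rewrite mem_iota.
  by have [_ /(_ a) [_ ->]] := HS p.
case: HT => uT TP _ _; apply: fsbig_eq_seq => //.
  by move=> a /TP.
by move=> a [aA aw] /negP []; apply/TP.
Qed.

(** The local norm formulas reduce this to the product formula of Q for the norm of [c]. *)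
Lemma product_formula (c : k) : c != 0 ->
  exists B0, forall B, (B0 <= B)%N ->
    (\prod_(a <- places_below S B) a c ^+ local_degree a) *
    (\prod_(a <- T) a c ^+ local_degree a) = 1.
Proof.
move=> cN0; have detN0 : \det (mulmat c) != 0.
  apply/eqP => d0; have := mulmatM c c^-1; rewrite mulfV // mulmat1 => /(congr1 determinant).
  by rewrite det1 det_mulmx d0 mul0r => /eqP; rewrite oner_eq0.
have [B0 HB0] := product_formula_rat R detN0; exists B0 => B /HB0 E; rewrite -[RHS]E.
case: HT => _ _ _ ->; congr (_ * _); rewrite big_places_below //.
by apply: eq_bigr => p pp; have [_ _ ->] := HS p.
Qed.

Lemma heightZ (I : finType) (b : I -> k) (c : k) i0 : c != 0 -> b i0 != 0 ->
  height (fun i => c * b i) = height b.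
Proof.
move=> cN0 bi0; have cbi0 : c * b i0 != 0 by rewrite mulf_neq0.
have [B0 H0] := product_formula cN0; have [B1 H1] := heightE bi0.
have [B2 H2] := heightE (cbi0 : (fun i => c * b i) i0 != 0).
pose B := maxn B0 (maxn B1 B2).
rewrite (H1 B) ?(H2 B) ?leq_max ?leqnn ?orbT //.
congr powR; have /H0 E : (B0 <= B)%N by rewrite leq_max leqnn.
rewrite -[RHS]mul1r -[X in X * _]E /height_prod mulrACA -!big_split /=; congr (_ * _); apply: eq_big_seq => a ain.
  by rewrite (vmaxZ (absval_below ain)) exprMn.
by rewrite (vl2Z (absval_T ain)) exprMn.
Qed.

Section Compare.
Variables (I J : finType) (b : I -> k) (b' : J -> k) (phi : I -> J) (i0 : I).
Hypotheses (bi0 : b i0 != 0) (phi_inj : {in [pred i | b i != 0] &, injective phi}).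
Hypothesis phi_sgn : forall i, b i != 0 -> b' (phi i) = b i \/ b' (phi i) = - b i.

Let phiE (a : k -> R) : absval a -> forall i, b i != 0 -> a (b' (phi i)) = a (b i).
Proof. by move=> aA i /phi_sgn [->|->] //; rewrite (absvalN aA). Qed.

Let b'i0 : b' (phi i0) != 0.
Proof. by case: (phi_sgn bi0) => ->; rewrite ?oppr_eq0. Qed.

Let nonarch_le B : \prod_(a <- places_below S B) vmax a b ^+ local_degree a <=
  \prod_(a <- places_below S B) vmax a b' ^+ local_degree a.
Proof.
rewrite big_seq_cond [leRHS]big_seq_cond; apply: ler_prod => a /andP[/absval_below aA _].
rewrite exprn_ge0 ?vmax_ge0 //=; apply: lerXn2r; rewrite ?nnegrE ?vmax_ge0 //.
exact: (le_vmax_embed aA (phiE aA)).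
Qed.

Let arch_le (r : seq (k -> R)) : {subset r <= T} ->
  \prod_(a <- r) vl2 a b ^+ local_degree a <= \prod_(a <- r) vl2 a b' ^+ local_degree a.
Proof.
move=> rT.
rewrite big_seq_cond [leRHS]big_seq_cond; apply: ler_prod => a /andP[/rT/absval_T aA _].
rewrite exprn_ge0 ?sqrtr_ge0 //=; apply: lerXn2r; rewrite ?nnegrE ?sqrtr_ge0 //.
exact: (le_vl2_embed aA phi_inj (phiE aA)).
Qed.

Let prod_ge0 (r : seq (k -> R)) (F : (k -> R) -> R) (e : (k -> R) -> nat) :
  (forall a, 0 <= F a) -> 0 <= \prod_(a <- r) F a ^+ e a.
Proof. by move=> F0; apply: prodr_ge0 => a _; apply: exprn_ge0. Qed.

(** Signs do not affect absolute values, so [phi] makes every local norm increase. *)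
Lemma height_le : height b <= height b'.
Proof.
have [B1 H1] := heightE bi0; have [B2 H2] := heightE b'i0.
rewrite (H1 (maxn B1 B2)) ?(H2 (maxn B1 B2)) ?leq_max ?leqnn ?orbT //.
apply: ge0_ler_powR; rewrite ?invr_ge0 ?ler0n //.
- by rewrite nnegrE mulr_ge0 ?prod_ge0 // => a; rewrite ?vmax_ge0 ?sqrtr_ge0.
- by rewrite nnegrE mulr_ge0 ?prod_ge0 // => a; rewrite ?vmax_ge0 ?sqrtr_ge0.
apply: ler_pM; rewrite ?prod_ge0 ?arch_le // => a; by rewrite ?vmax_ge0 ?sqrtr_ge0.
Qed.

(** A coordinate of [b'] outside the image makes the Euclidean norm strictly larger at one
    archimedean place. As its local degree is positive and the other factors are positive and do not
    decrease, the height is strictly larger. *)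
Lemma height_eq_support : height b = height b' ->
  forall j, b' j != 0 -> exists2 i, b i != 0 & j = phi i.
Proof.
case: (HT) => uT TP T0 _.
have [a aT] : exists a, a \in T by case: (T) T0 => // a r _; exists a; rewrite mem_head.
have aA := absval_T aT.
move=> E; apply: (vl2_embed_eq aA phi_inj (phiE aA)); move: E.
apply: contra_eq => neq; rewrite lt_eqF //.
have [B1 H1] := heightE bi0; have [B2 H2] := heightE b'i0.
rewrite (H1 (maxn B1 B2)) ?(H2 (maxn B1 B2)) ?leq_max ?leqnn ?orbT //.
apply: gt0_ltr_powR; rewrite ?invr_gt0 ?ltr0n ?(adim_gt0 (aspacef k)) //.
- by rewrite nnegrE mulr_ge0 ?prod_ge0 // => a'; rewrite ?vmax_ge0 ?sqrtr_ge0.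
- by rewrite nnegrE mulr_ge0 ?prod_ge0 // => a'; rewrite ?vmax_ge0 ?sqrtr_ge0.
rewrite /height_prod; set B := maxn _ _.
have v0 : 0 < \prod_(a <- places_below S B) vmax a b ^+ local_degree a.
  rewrite big_seq_cond; apply: prodr_gt0 => a' /andP[/absval_below a'A _].
  by rewrite exprn_gt0 // (vmax_gt0 a'A bi0).
apply: (@lt_le_trans _ _ ((\prod_(a <- places_below S B) vmax a b ^+ local_degree a) *
  \prod_(a <- T) vl2 a b' ^+ local_degree a)); last first.
  by apply: ler_wpM2r => //; apply: prod_ge0 => a'; apply: sqrtr_ge0.
rewrite ltr_pM2l // !(perm_big _ (perm_to_rem aT)) !big_cons.
have r0 : 0 < \prod_(a' <- rem a T) vl2 a' b ^+ local_degree a'.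
  rewrite big_seq_cond; apply: prodr_gt0 => a' /andP[/mem_rem/absval_T a'A _].
  by rewrite exprn_gt0 // (vl2_gt0 a'A bi0).
apply: (@lt_le_trans _ _ (vl2 a b' ^+ local_degree a *
    \prod_(a' <- rem a T) vl2 a' b ^+ local_degree a')); last first.
  by apply: ler_wpM2l; [rewrite exprn_ge0 ?sqrtr_ge0 | apply: arch_le => x /mem_rem].
rewrite ltr_pM2r // ltrXn2r ?sqrtr_ge0 //; first by rewrite -lt0n (local_degree_gt0 (proj1 (TP a) aT)).
rewrite lt_neqAle neq (le_vl2_embed aA phi_inj (phiE aA)) //.
Qed.
End Compare.
End Heights.

(** * Grassmann coordinates *)

Section Minors.
Variables (k : fieldExtType rat) (N : nat).

Lemma minor_enum m (X : 'M[k]_(N, m)) (S : {set 'I_N}) : #|S| = m ->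
  exists f : 'I_m -> 'I_N, [/\ injective f, S = [set f i | i : 'I_m] &
    minor X S = \det (rowsub f X)].
Proof.
move=> cS; case: m / cS X => X; exists (@enum_val _ (mem S)); split.
- exact: enum_val_inj.
- apply/setP => x; apply/idP/imsetP => [xS|[i _ ->]]; last exact: enum_valP.
  by exists (enum_rank_in xS x) => //; rewrite enum_rankK_in.
congr determinant; apply/matrixP => i j; rewrite !mxE.
by rewrite (nth_map (enum_val i)) -?cardE // -enum_val_nth.
Qed.

(** Two enumerations of the same row set differ by a permutation, which costs a sign. *)
Lemma minor_rowsub m (X : 'M[k]_(N, m)) (f : 'I_m -> 'I_N) (S : {set 'I_N}) :
  injective f -> S = [set f i | i : 'I_m] ->
  minor X S = \det (rowsub f X) \/ minor X S = - \det (rowsub f X).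
Proof.
move=> f_inj ES.
have [g [g_inj Eg ->]] := @minor_enum m X S ltac:(by rewrite ES card_imset // card_ord).
have gf i : exists j, g j == f i.
  have : f i \in S by rewrite ES imset_f.
  by rewrite Eg => /imsetP[j _ ->]; exists j.
pose s i := xchoose (gf i); have gs i : g (s i) = f i := eqP (xchooseP (gf i)).
have s_inj : injective s by move=> i j E; apply: f_inj; rewrite -!gs E.
have -> : rowsub f X = row_perm (perm s_inj) (rowsub g X).
  by apply/matrixP => i j; rewrite !mxE permE gs.
rewrite row_permE det_mulmx det_perm.
by case: (odd_perm _); rewrite ?expr1 ?expr0 ?mulN1r ?mul1r ?opprK; [right | left].
Qed.

Lemma minorM m (X : 'M[k]_(N, m)) (P : 'M[k]_m) (S : {set 'I_N}) : #|S| = m ->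
  minor (X *m P) S = \det P * minor X S.
Proof.
move=> cS; rewrite /minor mulrC -det_mulmx; congr determinant.
apply/matrixP => i j; rewrite !mxE (nth_map (nth (enum_val (cast_ord (esym cS) i)) (enum S) i)); last first.
  by rewrite -cardE cS.
rewrite mxE; apply: eq_bigr => l _; rewrite mxE (nth_map (enum_val (cast_ord (esym cS) i))) -?cardE ?cS //.
by congr (X _ _ * _); apply: set_nth_default; rewrite -cardE cS.
Qed.

Definition lin_cols m (X : 'M[k]_(N, m)) : seq 'cV[k]_N := [seq col j X | j <- enum 'I_m].

Lemma mulmx_cols m n (X : 'M[k]_(N, m)) (P : 'M[k]_(m, n)) j :
  col j (X *m P) = \sum_l P l j *: col l X.
Proof.
apply/colP => i; rewrite !mxE summxE; apply: eq_bigr => l _.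
by rewrite !mxE mulrC.
Qed.

Lemma span_colsM m n (X : 'M[k]_(N, m)) (P : 'M[k]_(m, n)) :
  (<<lin_cols (X *m P)>> <= <<lin_cols X>>)%VS.
Proof.
apply/span_subvP => _ /mapP[j _ ->]; rewrite mulmx_cols; apply: rpred_sum => l _.
by apply: rpredZ; apply/memv_span/map_f; rewrite mem_enum.
Qed.

Lemma span_cols_factor m n (X : 'M[k]_(N, m)) (v : 'I_n -> 'cV[k]_N) :
  (forall j, v j \in <<lin_cols X>>%VS) ->
  exists P : 'M[k]_(m, n), \matrix_(i, j) v j i 0 = X *m P.
Proof.
move=> Hv; pose t : m.-tuple 'cV[k]_N := [tuple col j X | j < m].
exists (\matrix_(l, j) coord t l (v j)); apply/matrixP => i j.
rewrite [LHS]mxE [in LHS](coord_span (Hv j : v j \in <<t>>%VS)) summxE [RHS]mxE.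
apply: eq_bigr => l _; rewrite [LHS]mxE [(\matrix_(_, _) _) l j]mxE mulrC; congr (_ * _).
by rewrite -(tnth_nth 0 t l) tnth_mktuple mxE.
Qed.

(** A change of basis multiplies all minors by its determinant, which leaves the height unchanged by
    [heightZ]. *)
Lemma subspace_heightE (R : realType) (W : {vspace 'cV[k]_N}) m (X : 'M[k]_(N, m))
    (S0 : {S : {set 'I_N} | #|S| == m}) :
  basis_of W (lin_cols X) -> grassmann X S0 != 0 ->
  subspace_height R W = height R (grassmann X).
Proof.
move=> bX gX.
have Em : \dim W = m by rewrite (size_basis (X := in_tuple (lin_cols X)) bX) size_map size_enum_ord.
rewrite /subspace_height; move: X S0 bX gX; rewrite -Em => X S0 bX gX.
set V := \matrix_(i, j) _.
have sX : <<lin_cols X>>%VS = W := span_basis bX.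
have [P EP] : exists P : 'M[k]_(\dim W), V = X *m P.
  by apply: span_cols_factor => j; rewrite sX; apply: vbasis_mem; apply: mem_tnth.
have [Q EQ] : exists Q : 'M[k]_(\dim W), X = V *m Q.
  have [Q EQ] : exists Q : 'M[k]_(\dim W), \matrix_(i, j) (col j X) i 0 = V *m Q.
    apply: span_cols_factor => j.
    have -> : lin_cols V = vbasis W.
      rewrite -[RHS]map_tnth_enum; apply: eq_map => l.
      by apply/colP => i; rewrite !mxE.
    rewrite (span_basis (vbasisP W)).
    have : col j X \in <<lin_cols X>>%VS by apply/memv_span/map_f; rewrite mem_enum.
    by rewrite sX.
  by exists Q; rewrite -EQ; apply/matrixP => i j; rewrite !mxE.
have gM (Y : 'M[k]_(N, \dim W)) (D : 'M_(\dim W)) S : grassmann (Y *m D) S = \det D * grassmann Y S.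
  by rewrite /grassmann minorM //; apply/eqP/(svalP S).
(* From X = X P Q, a vanishing det P would annihilate the nonzero minor at [S0]. *)
have dP : \det P != 0.
  by apply: contraNneq gX => dP0; rewrite EQ EP !gM dP0 mul0r mulr0.
have -> : grassmann V = fun S => \det P * grassmann X S.
  by apply: boolp.funext => S; rewrite EP gM.
have [NS HNS] := exists_nonarch_data R k; have [T HT] := exists_arch_data R k.
exact: (heightZ HNS HT dP gX).
Qed.
End Minors.

(** * Reduced bases *)

Section ReducedBasis.
Variables (R : realType) (k : fieldExtType rat) (N L : nat) (Om : 'M[k]_(N, L)) (r : 'I_L -> 'I_N).
Hypotheses (r_inj : injective r) (OmE : forall i j, Om (r i) j = (i == j)%:R).

Lemma free_colsub m (h : 'I_m -> 'I_L) : injective h -> free (lin_cols (colsub h Om)).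
Proof.
move=> h_inj; pose t := [tuple col j (colsub h Om) | j < m].
apply/(@freeP _ _ _ t) => c Hc i.
have := congr1 (fun v : 'cV[k]_N => v (r (h i)) 0) Hc.
rewrite summxE mxE (bigD1 i) //= -(tnth_nth 0 t i) tnth_mktuple !mxE OmE eqxx mulr1.
rewrite big1 ?addr0 // => j ji.
by rewrite -(tnth_nth 0 t j) tnth_mktuple !mxE OmE (inj_eq h_inj) eq_sym (negbTE ji) mulr0.
Qed.

Lemma det_unit_rows m (h : 'I_m -> 'I_L) : injective h ->
  \det (rowsub (r \o h) (colsub h Om)) = 1.
Proof.
move=> h_inj; rewrite (_ : rowsub _ _ = 1%:M) ?det1 //.
by apply/matrixP => i j; rewrite !mxE OmE (inj_eq h_inj).
Qed.

(** The rows at which the minor of the chosen columns is 1 or -1; also the default value in [up] and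
    [down]. *)
Let unit_set m (h : 'I_m -> 'I_L) (h_inj : injective h) :
  {S : {set 'I_N} | #|S| == m}.
Proof.
exists [set r (h i) | i : 'I_m]; apply/eqP.
by rewrite card_imset ?card_ord // => i j /r_inj /h_inj.
Defined.

Lemma grassmann_unit_set m (h : 'I_m -> 'I_L) (h_inj : injective h) :
  grassmann (colsub h Om) (unit_set h_inj) != 0.
Proof.
have rh_inj : injective (r \o h) by move=> i j /r_inj /h_inj.
by rewrite /grassmann /=; have [->|->] := minor_rowsub (colsub h Om) rh_inj (erefl _);
   rewrite det_unit_rows // ?oppr_eq0 oner_eq0.
Qed.

Lemma span_height m (h : 'I_m -> 'I_L) (I : {set 'I_L}) :
  injective h -> I = [set h i | i : 'I_m] ->
  subspace_height R <<[seq col i Om | i <- enum I]>> = height R (grassmann (colsub h Om)).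
Proof.
move=> h_inj EI; apply: (subspace_heightE _ (S0 := unit_set h_inj)).
  rewrite /basis_of free_colsub // andbT; apply/eqP/eq_span => v.
  have colE j : col j (colsub h Om) = col (h j) Om by apply/colP => x; rewrite !mxE.
  apply/mapP/mapP => [[j _ ->]|[i]].
    by exists (h j); rewrite ?colE // mem_enum EI imset_f.
  by rewrite mem_enum EI => /imsetP[j _ ->] ->; exists j; rewrite ?colE ?mem_enum.
exact: grassmann_unit_set.
Qed.

Section Extension.
Variables (m t : nat) (h1 : 'I_m -> 'I_L) (h2 : 'I_t -> 'I_L).
Let h (i : 'I_(m + t)) := match fintype.split i with inl j => h1 j | inr j => h2 j end.
Hypothesis h_inj : injective h.

Let h_l i : h (lshift t i) = h1 i.
Proof. by rewrite /h (unsplitK (inl i)). Qed.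
Let h_r i : h (rshift m i) = h2 i.
Proof. by rewrite /h (unsplitK (inr i)). Qed.
Let h1_inj : injective h1.
Proof. by move=> i j E; apply: (@lshift_inj m t); apply: h_inj; rewrite !h_l. Qed.
Let h2_inj : injective h2.
Proof. by move=> i j E; apply: (@rshift_inj m t); apply: h_inj; rewrite !h_r. Qed.
Let h12 i j : (h2 j == h1 i) = false.
Proof.
by rewrite -h_l -h_r (inj_eq h_inj) eq_sym; apply/negbTE/eqP => /eqP; rewrite eq_lrshift.
Qed.

Let T : {set 'I_N} := [set r (h2 j) | j : 'I_t].
Let X1 := colsub h1 Om.
Let X := colsub h Om.
Let join (f : 'I_m -> 'I_N) (i : 'I_(m + t)) :=
  match fintype.split i with inl j => f j | inr j => r (h2 j) end.

(** On the rows [T] the old columns vanish and the new ones form the identity, so the submatrix is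
    block triangular. *)
Let det_join (f : 'I_m -> 'I_N) : \det (rowsub (join f) X) = \det (rowsub f X1).
Proof.
have -> : rowsub (join f) X =
    block_mx (rowsub f X1) (rowsub f (colsub h2 Om)) 0 1%:M.
  rewrite -[LHS]submxK; congr block_mx; apply/matrixP => i j; rewrite !mxE /join.
  - by rewrite (unsplitK (inl i)) h_l.
  - by rewrite (unsplitK (inl i)) h_r.
  - by rewrite (unsplitK (inr i)) h_l OmE h12.
  - by rewrite (unsplitK (inr i)) h_r OmE (inj_eq h2_inj).
by rewrite det_ublock det1 mulr1.
Qed.

Let join_facts (f : 'I_m -> 'I_N) : injective f -> (forall i, f i \notin T) ->
  injective (join f) /\ [set join f i | i : 'I_(m + t)] = [set f i | i : 'I_m] :|: T.
Proof.
move=> f_inj fT; have fT' i j : f i = r (h2 j) -> False.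
  by move=> E; have := fT i; rewrite E imset_f.
split.
  move=> i j; rewrite /join -[i in X in _ -> X]splitK -[j in X in _ -> X]splitK.
  case: (fintype.split i) (fintype.split j) => [a|a] [b|b] E; congr unsplit.
  - by rewrite (f_inj _ _ E).
  - by case: (fT' _ _ E).
  - by case: (fT' _ _ (esym E)).
  - by rewrite (h2_inj (r_inj E)).
apply/setP => x; apply/imsetP/setUP => [[i _ ->]|[|] /imsetP[j _ ->]].
- by rewrite /join; case: (fintype.split i) => j; [left|right]; apply: imset_f.
- by exists (lshift t j); rewrite // /join (unsplitK (inl j)).
- by exists (rshift m j); rewrite // /join (unsplitK (inr j)).
Qed.

(** A row of [T] is zero in the old columns. *)
Let minor_neq0_disjoint (f : 'I_m -> 'I_N) : \det (rowsub f X1) != 0 -> forall i, f i \notin T.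
Proof.
move=> dN0 i; apply: contraNN dN0 => /imsetP[j _ E].
rewrite (expand_det_row _ i) big1 // => l _.
by rewrite !mxE E OmE h12 mul0r.
Qed.

Let S1 := unit_set h1_inj.
Let S2 := unit_set h_inj.
(** Adjoining and removing [T] are meant to be mutually inverse on nonzero minors; the default of
    [insubd] covers only sets of the wrong cardinality. *)
Let up (S : {S : {set 'I_N} | #|S| == m}) : {S : {set 'I_N} | #|S| == (m + t)%N} :=
  insubd S2 (val S :|: T).
Let down (S : {S : {set 'I_N} | #|S| == (m + t)%N}) : {S : {set 'I_N} | #|S| == m} :=
  insubd S1 (val S :\: T).

Let up_facts S : grassmann X1 S != 0 ->
  [/\ val (up S) = val S :|: T, [disjoint val S & T] &
      grassmann X (up S) = grassmann X1 S \/ grassmann X (up S) = - grassmann X1 S].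
Proof.
case: S => S cS; rewrite /grassmann /= => gS.
have [f [f_inj ES Ef]] := minor_enum X1 (eqP cS).
rewrite Ef in gS; have fT := minor_neq0_disjoint gS.
have [j_inj Ej] := join_facts f_inj fT.
have Eup : val (up (exist _ S cS)) = S :|: T.
  rewrite /up val_insubd /= [in X in if X then _ else _]ES -Ej.
  by rewrite card_imset // card_ord eqxx.
split=> //.
  rewrite -setI_eq0; apply/eqP/setP => x; rewrite !inE ES; apply/negbTE/negP => /andP[].
  by move/imsetP => [i _ ->]; apply/negP.
rewrite Eup Ef -det_join; apply: minor_rowsub => //.
by rewrite Ej -ES.
Qed.

Let up_inj : {in [pred S | grassmann X1 S != 0] &, injective up}.
Proof.
move=> S S' /up_facts[E dis _] /up_facts[E' dis' _] EE; apply: val_inj.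
have := congr1 val EE; rewrite E E' => /(congr1 (fun A => A :\: T)).
rewrite !finset.setDUl !finset.setDv !finset.setU0.
by move/finset.setDidPl: dis => ->; move/finset.setDidPl: dis' => ->.
Qed.

Lemma height_colsub_le : height R (grassmann X1) <= height R (grassmann X).
Proof.
have [NS HNS] := exists_nonarch_data R k; have [AT HT] := exists_arch_data R k.
apply: (height_le HNS HT (i0 := S1) (phi := up)).
- exact: grassmann_unit_set.
- exact: up_inj.
- by move=> S /up_facts[].
Qed.

(** Putting row [x] in place of one row of the identity leaves a single entry as determinant; this
    produces minors that avoid a row of [T]. *)
Let det_one_row (i0 : 'I_(m + t)) x :
  \det (rowsub (fun i => if i == i0 then x else r (h i)) X) = Om x (h i0).
Proof.
rewrite (expand_det_col _ i0) (bigD1 i0) //= big1 ?addr0; last first.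
  by move=> i ii0; rewrite !mxE (negbTE ii0) OmE (inj_eq h_inj) (negbTE ii0) mul0r.
rewrite !mxE eqxx /cofactor addnn -signr_odd odd_double expr0 mul1r.
rewrite (_ : row' _ _ = 1%:M) ?det1 ?mulr1 //.
apply/matrixP => i j; rewrite !mxE eq_sym (negbTE (neq_lift _ _)) OmE (inj_eq h_inj).
by rewrite (inj_eq lift_inj).
Qed.

(** Equality puts every nonzero minor in the image of [up], so its rows include [T], and
    [det_one_row] excludes extra entries in the new columns. Conversely, standard columns make
    [down] available for the reverse inequality. *)
Lemma height_colsub_eq :
  height R (grassmann X1) = height R (grassmann X) <->
  forall j, exists i, col (h2 j) Om = delta_mx i 0.
Proof.
have [NS HNS] := exists_nonarch_data R k; have [AT HT] := exists_arch_data R k.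
split=> [E j|std].
  have supp := height_eq_support HNS HT (grassmann_unit_set h1_inj) up_inj
    (fun S HS => let: And3 _ _ H := up_facts HS in H) E.
  exists (r (h2 j)); apply/colP => x; rewrite !mxE andbT.
  case: eqP => [->|xr]; first by rewrite OmE eqxx.
  (* A second nonzero entry, in row [x], allows [x] to replace the row [r (h2 j)] in a nonzero
     minor. *)
  apply/eqP/negP => /negP OxN0; pose f i := if i == rshift m j then x else r (h i).
  have xrh i : i != rshift m j -> x <> r (h i).
    move=> ij Ex; move: OxN0; rewrite Ex OmE -h_r (inj_eq h_inj) (negbTE ij).
    by rewrite eqxx.
  have f_inj : injective f.
    move=> i i'; rewrite /f; case: (altP (i =P _)) => [->|Hi]; case: (altP (i' =P _)) => [->|Hi'] //.
    - by move/(xrh _ Hi').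
    - by move/esym/(xrh _ Hi).
    - by move/r_inj/h_inj.
  have cS : #|[set f i | i : 'I_(m + t)]| == (m + t)%N by rewrite card_imset // card_ord.
  have gN0 : grassmann X (exist (fun S : {set 'I_N} => #|S| == (m + t)%N) _ cS) != 0.
    rewrite /grassmann /=; have [->|->] := minor_rowsub X f_inj (erefl _);
      by rewrite det_one_row h_r ?oppr_eq0.
  have [S gS ES] := supp _ gN0; have [Eup _ _] := up_facts gS.
  have : r (h2 j) \in [set f i | i : 'I_(m + t)].
    have -> : [set f i | i : 'I_(m + t)] = val (up S) by rewrite -ES.
    by rewrite Eup inE [X in _ || X]imset_f ?orbT.
  case/imsetP => i _; rewrite /f; case: eqP => [_ /esym//|ni].
  by rewrite -h_r => /r_inj/h_inj/esym.
(* Without the row [r (h2 j)], the submatrix has a zero column. *)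
have TS S : grassmann X S != 0 -> T \subset val S.
  case: S => S cS; rewrite /grassmann /=; have [f [f_inj ES ->]] := minor_enum X (eqP cS).
  move=> dN0; apply/fintype.subsetP => _ /imsetP[j _ ->]; apply: contraNT dN0 => nS.
  have [i Hi] := std j.
  have Oe x : Om x (h2 j) = (x == i)%:R.
    by have := congr1 (fun v : 'cV[k]_N => v x 0) Hi; rewrite !mxE andbT.
  have Ei : i = r (h2 j).
    by have := Oe (r (h2 j)); rewrite OmE eqxx; case: eqP => // _ /eqP; rewrite oner_eq0.
  rewrite (expand_det_col _ (rshift m j)) big1 // => l _.
  rewrite !mxE h_r Oe Ei; case: eqP => [E|_]; last by rewrite mul0r.
  by move: nS; rewrite -E ES imset_f.
have down_facts S : grassmann X S != 0 -> val (down S) = val S :\: T /\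
    (grassmann X1 (down S) = grassmann X S \/ grassmann X1 (down S) = - grassmann X S).
  move=> gS; have sTS := TS _ gS.
  have cT : #|T| = t by rewrite card_imset ?card_ord // => i j /r_inj/h2_inj.
  have cD : #|val S :\: T| == m.
    by rewrite cardsDS // cT (eqP (valP S)) addnK.
  have Ed : val (down S) = val S :\: T by rewrite /down val_insubd cD.
  split=> //; rewrite /grassmann Ed.
  have [f [f_inj Ef ->]] := minor_enum X1 (eqP cD).
  have fT i : f i \notin T.
    have : f i \in val S :\: T by rewrite Ef imset_f.
    by rewrite inE => /andP[].
  have [j_inj Ej] := join_facts f_inj fT.
  rewrite -det_join.
  have ES : val S = [set join f i | i : 'I_(m + t)].
    by rewrite Ej -Ef finset.setUC finset.setDE finset.setUIr finset.setUCr finset.setIT; apply/esym/finset.setUidPr.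
  by have [->|->] := minor_rowsub X j_inj ES; [left|right; rewrite opprK].
apply/eqP; rewrite eq_le height_colsub_le /=.
apply: (height_le HNS HT (i0 := S2) (phi := down)).
- exact: grassmann_unit_set.
- move=> S S' /[dup] /down_facts[E _] /TS sT /[dup] /down_facts[E' _] /TS sT' EE; apply: val_inj.
  have := congr1 val EE; rewrite E E' => /(congr1 (fun A => T :|: A)).
  rewrite !finset.setDE !finset.setUIr !finset.setUCr !finset.setIT.
  by move/finset.setUidPr: sT => ->; move/finset.setUidPr: sT' => ->.
- by move=> S /down_facts[].
Qed.
End Extension.
End ReducedBasis.

(** * From enumerated columns to subsets of the basis *)

Section ReducedBasisSubsets.
Variables (R : realType) (k : fieldExtType rat) (N L : nat) (Om : 'M[k]_(N, L)) (r : 'I_L -> 'I_N).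
Hypotheses (r_inj : injective r) (OmE : forall i j, Om (r i) j = (i == j)%:R).

Lemma reduced_span_height_le (I1 I2 : {set 'I_L}) : I1 \subset I2 ->
  subspace_height R <<[seq col i Om | i <- enum I1]>> <=
  subspace_height R <<[seq col i Om | i <- enum I2]>> /\
  (subspace_height R <<[seq col i Om | i <- enum I1]>> =
   subspace_height R <<[seq col i Om | i <- enum I2]>> <->
   forall i, i \in I2 :\: I1 -> exists j : 'I_N, col i Om = delta_mx j ord0).
Proof.
move=> I12; pose D := I2 :\: I1.
pose h1 (i : 'I_#|I1|) := enum_val i; pose h2 (j : 'I_#|D|) := enum_val j.
(* Listing [I1] first and the added indices last matches the block form used above. *)
pose h (i : 'I_(#|I1| + #|D|)) := match fintype.split i with inl j => h1 j | inr j => h2 j end.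
have h1I i : h1 i \in I1 := enum_valP i.
have h2D j : h2 j \in D := enum_valP j.
have h_inj : injective h.
  move=> i j; rewrite /h -[i in X in _ -> X]splitK -[j in X in _ -> X]splitK.
  case: (fintype.split i) (fintype.split j) => [a|a] [b|b] E; congr unsplit.
  - by rewrite (enum_val_inj E).
  - by have := h2D b; rewrite -E inE h1I.
  - by have := h2D a; rewrite E inE h1I.
  - by rewrite (enum_val_inj E).
have E1 : I1 = [set h1 i | i : 'I_#|I1|].
  apply/setP => x; apply/idP/imsetP => [xI|[i _ ->]]; last exact: h1I.
  by exists (enum_rank_in xI x) => //; rewrite /h1 enum_rankK_in.
have E2 : I2 = [set h i | i : 'I_(#|I1| + #|D|)].
  apply/setP => x; apply/idP/imsetP => [xI|[i _ ->]]; last first.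
    rewrite /h; case: (fintype.split i) => j; first exact: (fintype.subsetP I12).
    by have := h2D j; rewrite inE => /andP[].
  have [xI1|xI1] := boolP (x \in I1).
    exists (lshift _ (enum_rank_in xI1 x)) => //.
    by rewrite /h (unsplitK (inl _)) /h1 enum_rankK_in.
  have xD : x \in D by rewrite inE xI1.
  exists (rshift _ (enum_rank_in xD x)) => //.
  by rewrite /h (unsplitK (inr _)) /h2 enum_rankK_in.
rewrite (span_height R r_inj OmE (@enum_val_inj _ _) E1) (span_height R r_inj OmE h_inj E2).
split; first exact: (height_colsub_le R r_inj OmE h_inj).
split=> [/(height_colsub_eq R r_inj OmE h_inj) H i iD|H].
  have [j Hj] := H (enum_rank_in iD i); exists j.
  by rewrite /h2 enum_rankK_in in Hj.
by apply/(height_colsub_eq R r_inj OmE h_inj) => j; apply: H.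
Qed.

(** The coordinates of a vector are the 1 x 1 minors of the line it spans. *)
Lemma reduced_vec_height_le (i : 'I_L) :
  vec_height R (col i Om) <= subspace_height R <<[seq col j Om | j <- enum [set i]]>>.
Proof.
pose h (_ : 'I_1) := i; have h_inj : injective h by move=> x y _; rewrite !ord1.
rewrite (span_height R r_inj OmE h_inj); last first.
  by apply/setP => x; rewrite inE; apply/eqP/imsetP => [->|[_ _ ->]//]; exists ord0.
have [NS HNS] := exists_nonarch_data R k; have [AT HT] := exists_arch_data R k.
pose phi (x : 'I_N) : {S : {set 'I_N} | #|S| == 1%N} :=
  exist (fun S : {set 'I_N} => #|S| == 1%N) [set x] (introT eqP (cards1 x)).
apply: (height_le HNS HT (i0 := r i) (phi := phi)).
- by rewrite mxE OmE eqxx oner_neq0.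
- by move=> x y _ _ /(congr1 val) /= /set1_inj.
move=> x _; pose f (_ : 'I_1) := x.
have f_inj : injective f by move=> a b _; rewrite !ord1.
have Ef : [set x] = [set f j | j : 'I_1].
  by apply/setP => y; rewrite inE; apply/eqP/imsetP => [->|[_ _ ->]//]; exists ord0.
have := minor_rowsub (colsub h Om) f_inj Ef.
by rewrite /grassmann /= det_mx11 !mxE.
Qed.
End ReducedBasisSubsets.

Theorem theorem1p1 (R : realType) (k : fieldExtType rat) (N L : nat)
  (A : 'M[k]_(N, L)) (r : 'I_L -> 'I_N) :
  (1 <= L)%N -> (L < N)%N ->
  \rank A = L ->
  (forall i j : 'I_L, (i < j)%N -> (r i < r j)%N) ->
  rowsub r A \in unitmx ->
  let Om := A *m invmx (rowsub r A) in
  let omega := fun i : 'I_L => col i Om in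
  let Z := (<<[seq col i A | i <- enum 'I_L]>>)%VS in
  let Y := fun I : {set 'I_L} => (<<[seq omega i | i <- enum I]>>)%VS in
  [/\ basis_of Z [seq omega i | i <- enum 'I_L],
      forall i : 'I_L, (#|[set j | omega i j ord0 != 0%R]| <= N - L + 1)%N,
      forall I : {set 'I_L}, I != set0 ->
        subspace_height R (Y I) <= subspace_height R Z,
      forall i : 'I_L, vec_height R (omega i) <= subspace_height R Z &
      forall I1 I2 : {set 'I_L}, I1 != set0 -> I1 \proper I2 ->
        subspace_height R (Y I1) <= subspace_height R (Y I2) /\
        (subspace_height R (Y I1) = subspace_height R (Y I2) <->
           forall i, i \in I2 :\: I1 -> exists j : 'I_N, omega i = delta_mx j ord0)].
Proof.
move=> L0 LN _ r_mono Bu Om omega Z Y.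
have r_inj : injective r.
  move=> i j E; apply: val_inj; case: (ltngtP i j) => // /r_mono; by rewrite E ltnn.
have OmE i j : Om (r i) j = (i == j)%:R.
  have : rowsub r Om = 1%:M by rewrite -mul_rowsub_mx mulmxV.
  by move/matrixP/(_ i j); rewrite !mxE.
have ZE : Z = <<lin_cols Om>>%VS.
  apply/eqP; rewrite eqEsubv span_colsM andbT.
  by have := span_colsM Om (rowsub r A); rewrite mulmxKV.
(* Taking the full index set reduces the bound by H(Z) to monotonicity. *)
have ZY : Z = Y [set: 'I_L].
  by rewrite ZE; apply: eq_span => v; apply/mapP/mapP => -[i _ ->]; exists i; rewrite ?mem_enum ?inE.
have YZ I : subspace_height R (Y I) <= subspace_height R Z.
  by rewrite ZY; apply: (reduced_span_height_le R r_inj OmE (finset.subsetT I)).1.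
split.
- rewrite /basis_of ZE eqxx /=.
  have := free_colsub OmE (@inj_id 'I_L).
  by rewrite (_ : colsub id Om = Om) //; apply/matrixP => x y; rewrite mxE.
(* The support of omega_i avoids the L - 1 rows [r j] with j different from i. *)
- move=> i; have sub : [set j | omega i j ord0 != 0%R] \subset ~: (r @: [set~ i]).
    apply/fintype.subsetP => x; rewrite !inE mxE; apply: contra => /imsetP[j].
    by rewrite !inE => ji ->; rewrite OmE (negbTE ji).
  apply: leq_trans (subset_leq_card sub) _.
  rewrite cardsCs finset.setCK card_imset // cardsC1 !card_ord -subn1 subnBA //.
  by rewrite [(N + 1)%N]addnC -addnBA ?(ltnW LN) // addnC.
- by move=> I _; apply: YZ.
- move=> i; apply: le_trans (YZ [set i]); exact: (reduced_vec_height_le R r_inj OmE i).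
- move=> I1 I2 _ /proper_sub I12; exact: (reduced_span_height_le R r_inj OmE I12).
Qed.
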